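(* Let $\mathbb X$ be a complex Banach space, $A$ a closed linear operator on $\mathbb X$, $\mathcal B$ an autonomous bounded linear operator on $BUC(\mathbb R,\mathbb X)$, and let $f:\mathbb R\to\mathbb X$ be an $l$-quasi-periodic function. Then there exists no $k$-quasi-periodic strong mild solution of the equation $\dot u(t)=Au(t)+[\mathcal Bu](t)+f(t)$, $t\in\mathbb R$, for any $k<l$.
   Context: $BUC(\mathbb R,\mathbb X)$ is the Banach space of bounded uniformly continuous functions $\mathbb R\to\mathbb X$ with sup-norm; $(S(t)g)(s)=g(t+s)$ is the translation group on it. $AP(\mathbb X)$ is the space of (Bohr) almost periodic functions $\mathbb R\to\mathbb X$. A bounded linear operator $\mathcal B$ on $BUC(\mathbb R,\mathbb X)$ is autonomous if $\mathcal BS(t)=S(t)\mathcal B$ for all $t\in\mathbb R$. For $g\in AP(\mathbb X)$ and $\lambda\in\mathbb R$, $a(\lambda,g):=\lim_{T\to\infty}\frac1{2T}\int_{-T}^Te^{-i\lambda t}g(t)\,dt$ (the limit exists); the Bohr spectrum is $\sigma_b(g):=\{\lambda\in\mathbb R:a(\lambda,g)\ne0\}$ and the module is $\mathfrak M(g):=\{\sum_{j=1}^Nn_j\lambda_j: N\in\mathbb N,\ \lambda_j\in\sigma_b(g),\ n_j\in\mathbb Z\}$. A finite or countable set of real numbers is rationally independent if no nontrivial finite linear combination of its elements with rational coefficients vanishes. A rationally independent set $\Omega$ is a rational basis of a set of reals if every element of that set is a finite linear combination of elements of $\Omega$ with rational coefficients; it is an integer basis if all these coefficients are integers. A function $g\in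 AP(\mathbb X)$ is $k$-quasi-periodic if $\mathfrak M(g)$ has a finite integer basis $\{\omega_1,\dots,\omega_k\}$ (of $k$ elements). Solutions: for $f\in BUC(\mathbb R,\mathbb X)$, $u\in BUC(\mathbb R,\mathbb X)$ is a classical solution of $\dot u(t)=Au(t)+[\mathcal Bu](t)+f(t)$ if $\dot u$ exists as an element of $BUC(\mathbb R,\mathbb X)$, $u(t)\in D(A)$ for all $t$, and the equation holds for all $t$. It is a strong mild solution if there are $f_n\in BUC(\mathbb R,\mathbb X)$ and classical solutions $u_n$ of the equation with $f$ replaced by $f_n$ such that $u_n\to u$ and $f_n\to f$ in the sup-norm.
   Formalization: In the definition of k-quasi-periodic, the integer basis is required to consist of elements of the module M(g), so k is its rank; otherwise the claim fails (A=0, B=0, u=e^{it}, f=ie^{it}, where M(f)=Z also has the integer basis {1,√2}). *)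

(* Defs.v *)
From Stdlib Require Import Reals ZArith QArith Qreals List.
From Coquelicot Require Import Coquelicot.

(* Stdlib reals with Coquelicot: a complex Banach space is a
   [CompleteNormedModule C_AbsRing]. *)

Open Scope R_scope.

(** Coquelicot states vector-valued derivatives and Riemann integrals over
    [R_AbsRing] only.  [realify X] is the complex Banach space [X] regarded as a
    real one: same carrier, addition, uniform structure and norm. *)

Section Realify.

Variable X : CompleteNormedModule C_AbsRing.

Definition realify_scal (r : R) (x : X) : X := scal (RtoC r : C_AbsRing) x.

Lemma realify_scal_assoc (r s : R) (x : X) :
  realify_scal r (realify_scal s x) = realify_scal (r * s) x.
Proof.
unfold realify_scal; rewrite scal_assoc; f_equal.
exact (eq_sym (RtoC_mult r s)).
Qed.

Lemma realify_scal_one (x : X) : realify_scal 1 x = x.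
Proof. exact (scal_one x). Qed.

Lemma realify_scal_distr_l (r : R) (x y : X) :
  realify_scal r (plus x y) = plus (realify_scal r x) (realify_scal r y).
Proof. exact (scal_distr_l _ x y). Qed.

Lemma realify_scal_distr_r (r s : R) (x : X) :
  realify_scal (r + s) x = plus (realify_scal r x) (realify_scal s x).
Proof.
unfold realify_scal.
rewrite (f_equal (fun c : C_AbsRing => scal c x) (RtoC_plus r s)).
exact (scal_distr_r (RtoC r : C_AbsRing) (RtoC s) x).
Qed.

Lemma realify_norm_scal (r : R) (x : X) :
  norm (realify_scal r x) <= Rabs r * norm x.
Proof. rewrite <- Cmod_R; exact (norm_scal (RtoC r : C_AbsRing) x). Qed.

Definition realify_ModuleSpace_mixin :
    ModuleSpace.mixin_of R_Ring (CompleteNormedModule.AbelianGroup C_AbsRing X) :=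
  ModuleSpace.Mixin R_Ring _ realify_scal realify_scal_assoc realify_scal_one
    realify_scal_distr_l realify_scal_distr_r.

Definition realify_NormedModuleAux : NormedModuleAux R_AbsRing :=
  NormedModuleAux.Pack R_AbsRing X
    (NormedModuleAux.Class R_AbsRing X
       (ModuleSpace.Class R_AbsRing X _ realify_ModuleSpace_mixin)
       (UniformSpace.class (CompleteNormedModule.UniformSpace C_AbsRing X))) X.

Definition realify_NormedModule_mixin :
    NormedModule.mixin_of R_AbsRing realify_NormedModuleAux :=
  NormedModule.Mixin R_AbsRing realify_NormedModuleAux
    (@norm C_AbsRing X) (@norm_factor C_AbsRing X)
    norm_triangle realify_norm_scal norm_compat1 norm_compat2 norm_eq_zero.

Definition realify : CompleteNormedModule R_AbsRing :=
  CompleteNormedModule.Pack R_AbsRing X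
    (CompleteNormedModule.Class R_AbsRing X
       (NormedModule.Class R_AbsRing X _ realify_NormedModule_mixin)
       (CompleteSpace.class (CompleteNormedModule.CompleteSpace C_AbsRing X))) X.

End Realify.

Arguments realify X : clear implicits.

Section Functions.

Context {X : CompleteNormedModule C_AbsRing}.

Definition uniformly_continuous (g : R -> X) : Prop :=
  forall eps : posreal, exists delta : posreal,
    forall s t : R, Rabs (s - t) < delta -> norm (minus (g s) (g t)) < eps.

Definition BUC (g : R -> X) : Prop :=
  (exists M : R, forall t : R, norm (g t) <= M) /\ uniformly_continuous g.

(** Junk value 0 if [g] is unbounded; only used for [g] in [BUC]. *)
Definition sup_norm (g : R -> X) : R :=
  real (Lub_Rbar (fun r => exists t : R, r = norm (g t))).

Definition translate (t : R) (g : R -> X) : R -> X := fun s => g (t + s).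

(** An operator on [BUC] is represented by a map on all functions; its values
    outside [BUC] are never used. *)
Definition bounded_linear_on_BUC (B : (R -> X) -> R -> X) : Prop :=
  (forall g, BUC g -> BUC (B g)) /\
  (forall g h, BUC g -> BUC h ->
     B (fun t => plus (g t) (h t)) = (fun t => plus (B g t) (B h t))) /\
  (forall (c : C) g, BUC g ->
     B (fun t => scal (c : C_AbsRing) (g t)) = (fun t => scal (c : C_AbsRing) (B g t))) /\
  (exists M : R, forall g, BUC g -> sup_norm (B g) <= M * sup_norm g).

Definition autonomous (B : (R -> X) -> R -> X) : Prop :=
  forall (t : R) g, BUC g -> B (translate t g) = translate t (B g).

(** An unbounded operator with domain [D] is represented by [D] and a map [A] on
    the whole space whose values outside [D] are never used. *)
Definition closed_linear_operator (D : X -> Prop) (A : X -> X) : Prop :=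
  D zero /\
  (forall x y, D x -> D y -> D (plus x y) /\ A (plus x y) = plus (A x) (A y)) /\
  (forall (c : C) x, D x ->
     D (scal (c : C_AbsRing) x) /\
     A (scal (c : C_AbsRing) x) = scal (c : C_AbsRing) (A x)) /\
  closed (fun p : X * X => D (fst p) /\ snd p = A (fst p)).

Definition classical_solution (D : X -> Prop) (A : X -> X)
    (B : (R -> X) -> R -> X) (f u : R -> X) : Prop :=
  BUC u /\
  exists du : R -> X, BUC du /\
    forall t : R,
      is_derive (V := realify X) u t (du t) /\
      D (u t) /\
      du t = plus (plus (A (u t)) (B u t)) (f t).

Definition strong_mild_solution (D : X -> Prop) (A : X -> X)
    (B : (R -> X) -> R -> X) (f u : R -> X) : Prop :=
  BUC f /\ BUC u /\
  exists fn un : nat -> R -> X,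
    (forall n, BUC (fn n) /\ classical_solution D A B (fn n) (un n)) /\
    is_lim_seq (fun n => sup_norm (fun t => minus (un n t) (u t))) 0 /\
    is_lim_seq (fun n => sup_norm (fun t => minus (fn n t) (f t))) 0.

(** Bohr's definition: for each [eps], the [eps]-almost periods are relatively
    dense in the line. *)
Definition almost_periodic (g : R -> X) : Prop :=
  (forall t : R, continuous g t) /\
  forall eps : posreal, exists L : R, 0 < L /\
    forall a : R, exists tau : R, a <= tau <= a + L /\
      forall t : R, norm (minus (g (t + tau)) (g t)) <= eps.

Definition expi (theta : R) : C := (cos theta, sin theta).

Definition is_bohr_coef (lambda : R) (g : R -> X) (a : X) : Prop :=
  filterlim
    (fun T : R =>
       scal (V := realify X) (/ (2 * T))
         (RInt (V := realify X)
            (fun t => scal (expi (- (lambda * t)) : C_AbsRing) (g t)) (- T) T))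
    (Rbar_locally p_infty) (locally a).

(** The coefficient is unique, and it exists for every almost periodic [g]. *)
Definition bohr_spectrum (g : R -> X) (lambda : R) : Prop :=
  exists a : X, is_bohr_coef lambda g a /\ a <> zero.

End Functions.

Definition lincomb (c : R -> R) (s : list R) : R :=
  fold_right (fun w acc => c w * w + acc) 0 s.

(** [s] may be empty, so [0] always belongs to the module. *)
Definition bohr_module {X : CompleteNormedModule C_AbsRing} (g : R -> X)
    (x : R) : Prop :=
  exists (s : list R) (n : R -> Z),
    (forall lambda, In lambda s -> bohr_spectrum g lambda) /\
    x = lincomb (fun w => IZR (n w)) s.

Definition rationally_independent (Omega : R -> Prop) : Prop :=
  forall (s : list R) (q : R -> Q),
    NoDup s -> (forall w, In w s -> Omega w) ->
    lincomb (fun w => Q2R (q w)) s = 0 ->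
    forall w, In w s -> (q w == 0)%Q.

Definition integer_basis (Omega M : R -> Prop) : Prop :=
  rationally_independent Omega /\
  forall x, M x -> exists (s : list R) (n : R -> Z),
    (forall w, In w s -> Omega w) /\ x = lincomb (fun w => IZR (n w)) s.

(** The basis is required to lie in the module.  Without this, adjoining to a
    basis reals that are rationally independent of it would make every
    [k]-quasi-periodic function [k']-quasi-periodic for all [k' >= k]; with it,
    [k] is the rank of the module. *)
Definition quasi_periodic {X : CompleteNormedModule C_AbsRing} (k : nat)
    (g : R -> X) : Prop :=
  almost_periodic g /\
  exists omega : list R,
    NoDup omega /\ length omega = k /\
    (forall w, In w omega -> bohr_module g w) /\
    integer_basis (fun w => In w omega) (bohr_module g).

(* Main.v *)
Require Import Defs.
From Stdlib Require Import Reals ZArith QArith Qreals List Lra Lia Classical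
  ClassicalEpsilon FunctionalExtensionality.
From Stdlib Require Import ssreflect.
From Coquelicot Require Import Coquelicot.

(** The Bohr spectrum of [f] is contained in that of [u], so the module of [f]
    is contained in the module of [u], and comparing ranks gives the result.

    For the inclusion, integrate the equation: closedness of [A] gives
    [A (int_x^y u) = u y - u x - int_x^y (B u) - int_x^y f] for every strong mild
    solution [u].  This relation is preserved by finite combinations of
    translations, which commute with [B].  Riemann sums of
    [1/(2T) int_{-T}^T exp(-i lambda t) S(t) dt] are such combinations; along
    large [T] they send [f] to approximately [exp(i lambda s) a(lambda, f)].  If
    the means of [exp(-i lambda t) u] come arbitrarily close to 0, they send [u]
    to functions of arbitrarily small sup norm, and closedness of [A] forces
    [a(lambda, f) = 0].  Otherwise these means are bounded away from 0; then every
    [eps]-almost period of [u] is an [O(eps)]-almost period of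
    [exp(-i lambda t) u], whence the mean exists and is nonzero. *)

Open Scope R_scope.

(** * Norm and distance estimates over complex scalars *)

Section NormedLemmas.

Context {X : CompleteNormedModule C_AbsRing}.

Lemma norm_plus_le (a b : X) : norm (plus a b) <= norm a + norm b.
Proof. exact (norm_triangle (V := X) a b). Qed.

Lemma norm_opp_eq (a : X) : norm (opp a) = norm a.
Proof. exact (norm_opp (V := X) a). Qed.

Lemma norm_zero_eq : norm (zero : X) = 0.
Proof. exact (norm_zero (V := X)). Qed.

Lemma norm_le_zero (a : X) : norm a <= 0 -> a = zero.
Proof.
intros H; apply (norm_eq_zero (V := X)), Rle_antisym; [exact H | apply norm_ge_0].
Qed.

Lemma plus_plus_swap (a b c d : X) :
  plus (plus a b) (plus c d) = plus (plus a c) (plus b d).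
Proof.
rewrite -!plus_assoc; f_equal; rewrite !plus_assoc; f_equal; apply plus_comm.
Qed.

Lemma minus_plus_plus (a b c d : X) :
  minus (plus a b) (plus c d) = plus (minus a c) (minus b d).
Proof.
unfold minus; rewrite opp_plus; apply plus_plus_swap.
Qed.

Lemma minus_minus_minus (a b c d : X) :
  minus (minus a b) (minus c d) = minus (minus a c) (minus b d).
Proof.
unfold minus at 2 3; rewrite minus_plus_plus.
unfold minus; rewrite !opp_plus; reflexivity.
Qed.

Lemma minus_plus_l (a b : X) : minus (plus a b) b = a.
Proof. unfold minus; rewrite -plus_assoc plus_opp_r; apply plus_zero_r. Qed.

Lemma dist_triangle (b a c : X) :
  norm (minus a c) <= norm (minus a b) + norm (minus b c).
Proof. rewrite (minus_trans b); apply norm_plus_le. Qed.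

Lemma norm_minus_sym (a b : X) : norm (minus a b) = norm (minus b a).
Proof. rewrite -opp_minus; apply norm_opp_eq. Qed.

Lemma dist_plus (a b c d : X) :
  norm (minus (plus a b) (plus c d)) <= norm (minus a c) + norm (minus b d).
Proof. rewrite minus_plus_plus; apply norm_plus_le. Qed.

Lemma norm_minus_le (a b : X) : norm (minus a b) <= norm a + norm b.
Proof. rewrite -(norm_opp_eq b); apply norm_plus_le. Qed.

Lemma dist_minus (a b c d : X) :
  norm (minus (minus a b) (minus c d)) <= norm (minus a c) + norm (minus b d).
Proof. rewrite minus_minus_minus; apply norm_minus_le. Qed.

Lemma minus_zero_l (a : X) : minus zero a = opp a.
Proof. apply plus_zero_l. Qed.

Lemma norm_le_dist (a b : X) : norm a <= norm (minus a b) + norm b.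
Proof.
generalize (dist_triangle b a zero); rewrite !minus_zero_r; tauto.
Qed.

Lemma dist_eq_zero (a b : X) : norm (minus a b) <= 0 -> a = b.
Proof.
intros H; assert (E : minus a b = zero)
  by now apply norm_le_zero.
apply (plus_reg_r (opp b)); rewrite plus_opp_r; exact E.
Qed.

Lemma dist_zero_of_eps (a b : X) (K : R) :
  (forall eps, 0 < eps -> norm (minus a b) <= K * eps) -> a = b.
Proof.
intros H; apply dist_eq_zero, le_epsilon; intros e he.
rewrite Rplus_0_l.
(* [K] may be zero or negative, so the error is rescaled by a positive majorant of it. *)
assert (hK : 0 < Rabs K + 1) by (generalize (Rabs_pos K); lra).
refine (Rle_trans _ _ _ (H (e / (Rabs K + 1)) (Rdiv_lt_0_compat _ _ he hK)) _).
replace e with ((Rabs K + 1) * (e / (Rabs K + 1))) at 2 by (field; lra).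
apply Rmult_le_compat_r; [left; apply Rdiv_lt_0_compat; lra|].
generalize (Rle_abs K); lra.
Qed.

Lemma norm_cscal_le (c : C) (x : X) (k : R) :
  Cmod c <= k -> norm (scal (c : C_AbsRing) x) <= k * norm x.
Proof.
intros H; refine (Rle_trans _ _ _ (norm_scal (V := X) (c : C_AbsRing) x) _).
apply Rmult_le_compat_r; [apply norm_ge_0 | exact H].
Qed.

(** A normed module provides only the upper bound. The reverse one is the upper bound for [Cinv c]
    applied to [scal c x]. *)
Lemma norm_cscal (c : C) (x : X) :
  norm (scal (c : C_AbsRing) x) = Cmod c * norm x.
Proof.
apply Rle_antisym; [exact (norm_scal (V := X) (c : C_AbsRing) x) |].
destruct (Req_dec (Cmod c) 0) as [E|E].
  rewrite E Rmult_0_l; apply norm_ge_0.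
assert (hc : c <> RtoC 0) by (intros ->; apply E, Cmod_0).
assert (h : x = scal (Cinv c : C_AbsRing) (scal (c : C_AbsRing) x)).
  rewrite scal_assoc.
  replace (mult (Cinv c : C_AbsRing) (c : C_AbsRing)) with (one : C_AbsRing).
    now rewrite scal_one.
  symmetry; exact (Cinv_l c hc).
rewrite {1}h.
generalize (norm_cscal_le (Cinv c) (scal (c : C_AbsRing) x) _ (Rle_refl _)).
intros h1.
apply (Rmult_le_compat_l (Cmod c)) in h1; [|apply Cmod_ge_0].
refine (Rle_trans _ _ _ h1 _).
rewrite (Cmod_inv _ hc).
right; field; exact E.
Qed.

End NormedLemmas.

(** * The unit circle map [expi] *)

Lemma lipschitz_of_derivative (g dg : R -> R) :
  (forall x, is_derive g x (dg x)) -> (forall x, Rabs (dg x) <= 1) ->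
  forall a b, Rabs (g a - g b) <= Rabs (a - b).
Proof.
intros H1 H2 a b.
destruct (MVT_gen g b a dg) as [c [_ E]].
- intros x _; apply H1.
- intros x _; apply derivable_continuous_pt; exists (dg x).
  apply is_derive_Reals, H1.
- rewrite E Rabs_mult.
  rewrite -{2}(Rmult_1_l (Rabs (a - b))).
  apply Rmult_le_compat_r; [apply Rabs_pos | apply H2].
Qed.

(** Cosine and sine are 1-Lipschitz, and the modulus is at most [sqrt 2] times the larger component;
    [sqrt 2] is rounded up to 2. *)
Lemma expi_lipschitz (a b : R) : Cmod (expi a - expi b) <= 2 * Rabs (a - b).
Proof.
unfold expi.
assert (h1 : Rabs (cos a - cos b) <= Rabs (a - b)).
  apply (lipschitz_of_derivative cos (fun x => - sin x)).
  - intros x; apply is_derive_Reals, derivable_pt_lim_cos.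
  - intros x; rewrite Rabs_Ropp; apply Rabs_le; generalize (SIN_bound x); lra.
assert (h2 : Rabs (sin a - sin b) <= Rabs (a - b)).
  apply (lipschitz_of_derivative sin cos).
  - intros x; apply is_derive_Reals, derivable_pt_lim_sin.
  - intros x; apply Rabs_le; generalize (COS_bound x); lra.
refine (Rle_trans _ _ _ (Cmod_2Rmax _) _); simpl.
assert (hs : sqrt 2 <= 2).
  replace 2 with (sqrt (2 ^ 2)) at 2 by (apply sqrt_pow2; lra).
  apply sqrt_le_1_alt; lra.
apply Rmult_le_compat; [apply sqrt_pos | | exact hs | now apply Rmax_lub].
apply Rle_trans with (2 := Rmax_l _ _); apply Rabs_pos.
Qed.

Lemma expi_add (a b : R) : expi (a + b) = (expi a * expi b)%C.
Proof.
unfold expi, Cmult; simpl; rewrite cos_plus sin_plus; f_equal; ring.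
Qed.

Lemma expi_0 : expi 0 = RtoC 1.
Proof. unfold expi; now rewrite cos_0 sin_0. Qed.

Lemma Cmod_expi (a : R) : Cmod (expi a) = 1.
Proof.
unfold Cmod, expi; simpl.
replace (cos a * (cos a * 1) + sin a * (sin a * 1)) with 1; [apply sqrt_1|].
generalize (sin2_cos2 a); unfold Rsqr; lra.
Qed.

(** * Riemann integrals of continuous vector-valued functions *)

Section Integral.

Context {X : CompleteNormedModule C_AbsRing}.

(* [realify X] is confined to [integ]; the algebra uses the complex structure. *)
Definition integ (g : R -> X) (a b : R) : X := RInt (V := realify X) g a b.

Definition cts (g : R -> X) : Prop := forall t, continuous g t.

Lemma cts_ex_RInt (g : R -> X) (a b : R) :
  cts g -> ex_RInt (V := realify X) g a b.
Proof.
intros H; apply (ex_RInt_continuous (V := realify X)); intros z _; exact (H z).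
Qed.

Lemma integ_plus (g h : R -> X) (a b : R) : cts g -> cts h ->
  integ (fun t => plus (g t) (h t)) a b = plus (integ g a b) (integ h a b).
Proof.
intros hg hh; exact (RInt_plus (V := realify X) g h a b
  (cts_ex_RInt g a b hg) (cts_ex_RInt h a b hh)).
Qed.

Lemma integ_minus (g h : R -> X) (a b : R) : cts g -> cts h ->
  integ (fun t => minus (g t) (h t)) a b = minus (integ g a b) (integ h a b).
Proof.
intros hg hh; exact (RInt_minus (V := realify X) g h a b
  (cts_ex_RInt g a b hg) (cts_ex_RInt h a b hh)).
Qed.

Lemma integ_Chasles (g : R -> X) (a b c : R) : cts g ->
  plus (integ g a b) (integ g b c) = integ g a c.
Proof.
intros hg; exact (RInt_Chasles (V := realify X) g a b c
  (cts_ex_RInt g a b hg) (cts_ex_RInt g b c hg)).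
Qed.

Lemma integ_shift (g : R -> X) (a b s : R) : cts g ->
  integ (fun t => g (t + s)) a b = integ g (a + s) (b + s).
Proof.
intros hg; unfold integ.
generalize (RInt_comp_lin (V := realify X) g 1 s a b); rewrite !Rmult_1_l.
intros H; rewrite -(H (cts_ex_RInt g _ _ hg)).
apply (RInt_ext (V := realify X)); intros t _.
rewrite Rmult_1_l; symmetry; apply (scal_one (V := realify X)).
Qed.

Lemma integ_const (x : X) (a b : R) :
  integ (fun _ => x) a b = scal (RtoC (b - a) : C_AbsRing) x.
Proof. exact (RInt_const (V := realify X) a b x). Qed.

Lemma integ_bound (g : R -> X) (a b M : R) : cts g -> a <= b ->
  (forall t, a <= t <= b -> norm (g t) <= M) -> norm (integ g a b) <= (b - a) * M.
Proof.
intros hg hab H.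
exact (norm_RInt_le_const (V := realify X) g a b _ M hab H
  (RInt_correct (V := realify X) g a b (cts_ex_RInt g a b hg))).
Qed.

Lemma integ_dist (g h : R -> X) (a b M : R) : cts g -> cts h -> a <= b ->
  (forall t, a <= t <= b -> norm (minus (g t) (h t)) <= M) ->
  norm (minus (integ g a b) (integ h a b)) <= (b - a) * M.
Proof.
intros hg hh hab H; rewrite -(integ_minus _ _ _ _ hg hh).
apply integ_bound; try assumption.
intros t; apply (continuous_minus (V := realify X)); [apply hg | apply hh].
Qed.

Lemma integ_point (g : R -> X) (a : R) : integ g a a = zero.
Proof. exact (RInt_point (V := realify X) a g). Qed.

Lemma integ_swap (g : R -> X) (a b : R) : cts g ->
  integ g a b = opp (integ g b a).
Proof.
intros hg; exact (eq_sym (opp_RInt_swap (V := realify X) g b a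
  (cts_ex_RInt g b a hg))).
Qed.

Lemma integ_bound_abs (g : R -> X) (a b M : R) : cts g ->
  (forall t, norm (g t) <= M) -> norm (integ g a b) <= Rabs (b - a) * M.
Proof.
intros hg H; destruct (Rle_dec a b) as [h|h].
  rewrite (Rabs_pos_eq (b - a)); [apply integ_bound; auto | lra].
rewrite (integ_swap g a b hg).
rewrite norm_opp_eq (Rabs_left (b - a) ltac:(lra)).
replace (- (b - a)) with (a - b) by ring.
apply integ_bound; auto; lra.
Qed.

(** Only two end pieces of length [Rabs s] change. The bound ignores the length of the window, so it
    disappears in means over long windows. *)
Lemma integ_window (g : R -> X) (a b s M : R) : cts g ->
  (forall t, norm (g t) <= M) ->
  norm (minus (integ g (a + s) (b + s)) (integ g a b)) <= 2 * M * Rabs s.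
Proof.
intros hg H.
rewrite -(integ_Chasles g (a + s) a (b + s) hg).
rewrite -(integ_Chasles g a b (b + s) hg).
assert (h1 := integ_bound_abs g (a + s) a M hg H).
assert (h2 := integ_bound_abs g b (b + s) M hg H).
replace (a - (a + s)) with (- s) in h1 by ring; rewrite Rabs_Ropp in h1.
replace (b + s - b) with s in h2 by ring.
rewrite (plus_comm (integ g a b)) plus_assoc.
rewrite minus_plus_l.
refine (Rle_trans _ _ _ (norm_plus_le _ _) _); lra.
Qed.

End Integral.

(** * The space [BUC], its sup norm and bounded operators on it *)

Section BoundedUniformlyContinuous.

Context {X : CompleteNormedModule C_AbsRing}.

Lemma BUC_cts (g : R -> X) : BUC g -> cts g.
Proof.
intros [_ H] t P [e He].
destruct (H e) as [d Hd]; exists d; intros s hs.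
apply He; exact (norm_compat1 (V := X) (g t) (g s) e (Hd s t hs)).
Qed.

Lemma BUC_zero : BUC (fun _ : R => zero : X).
Proof.
split.
- exists 0; intros _; rewrite norm_zero_eq; apply Rle_refl.
- intros e; exists (mkposreal 1 Rlt_0_1); intros s t _.
  rewrite minus_eq_zero norm_zero_eq; apply cond_pos.
Qed.

Lemma BUC_plus (g h : R -> X) :
  BUC g -> BUC h -> BUC (fun t => plus (g t) (h t)).
Proof.
intros [[M1 H1] U1] [[M2 H2] U2]; split.
- exists (M1 + M2); intros t.
  refine (Rle_trans _ _ _ (norm_plus_le _ _) _).
  now apply Rplus_le_compat.
- intros e; destruct (U1 (pos_div_2 e)) as [d1 h1].
  destruct (U2 (pos_div_2 e)) as [d2 h2].
  exists (mkposreal _ (Rmin_stable_in_posreal d1 d2)); simpl; intros s t hst.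
  refine (Rle_lt_trans _ _ _ (dist_plus _ _ _ _) _).
  rewrite -(Rplus_half_diag e); apply Rplus_lt_compat; [apply h1 | apply h2];
    apply (Rlt_le_trans _ _ _ hst); [apply Rmin_l | apply Rmin_r].
Qed.

Lemma BUC_scal (c : C) (g : R -> X) :
  BUC g -> BUC (fun t => scal (c : C_AbsRing) (g t)).
Proof.
intros [[M H] U]; split.
- exists (Cmod c * M); intros t; rewrite norm_cscal.
  apply Rmult_le_compat_l; [apply Cmod_ge_0 | apply H].
- intros e.
  assert (hk : 0 < Cmod c + 1) by (generalize (Cmod_ge_0 c); lra).
  destruct (U (mkposreal _ (Rdiv_lt_0_compat _ _ (cond_pos e) hk))) as [d hd].
  exists d; intros s t hst; specialize (hd s t hst); simpl in hd.
  rewrite -scal_minus_distr_l norm_cscal.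
  apply Rle_lt_trans with ((Cmod c + 1) * norm (minus (g s) (g t))).
    apply Rmult_le_compat_r; [apply norm_ge_0 | lra].
  apply (Rmult_lt_compat_l _ _ _ hk) in hd.
  replace (pos e) with ((Cmod c + 1) * (e / (Cmod c + 1))) by (field; lra).
  exact hd.
Qed.

Lemma opp_cscal (x : X) : opp x = scal (RtoC (-1) : C_AbsRing) x.
Proof.
rewrite -scal_opp_one; f_equal.
change (@opp (AbsRing.AbelianGroup C_AbsRing) one) with (Copp (RtoC 1)).
now rewrite RtoC_opp.
Qed.

(** [bounded_linear_on_BUC] speaks of sums and complex multiples, so differences are reduced to
    these. *)
Lemma minus_cscal (x y : X) :
  minus x y = plus x (scal (RtoC (-1) : C_AbsRing) y).
Proof. now rewrite -opp_cscal. Qed.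

Lemma BUC_minus (g h : R -> X) :
  BUC g -> BUC h -> BUC (fun t => minus (g t) (h t)).
Proof.
intros hg hh.
replace (fun t => minus (g t) (h t))
  with (fun t => plus (g t) (scal (RtoC (-1) : C_AbsRing) (h t))).
- now apply BUC_plus, BUC_scal.
- apply functional_extensionality; intros t; symmetry; apply minus_cscal.
Qed.

Lemma BUC_translate (t : R) (g : R -> X) : BUC g -> BUC (translate t g).
Proof.
intros [[M H] U]; split.
- exists M; intros s; apply H.
- intros e; destruct (U e) as [d hd]; exists d; intros s s' h.
  apply hd; replace (t + s - (t + s')) with (s - s') by ring; exact h.
Qed.

(** The integrand whose mean over symmetric windows is the Bohr coefficient of [g] at [lambda]. *)
Definition twist (lambda : R) (g : R -> X) : R -> X :=
  fun t => scal (expi (- (lambda * t)) : C_AbsRing) (g t).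

Lemma norm_expi_scal (theta : R) (x : X) :
  norm (scal (expi theta : C_AbsRing) x) = norm x.
Proof. rewrite norm_cscal Cmod_expi; ring. Qed.

(** The phase has modulus 1 and does not depend on [t], so it leaves integrals and carries no weight
    in norms. *)
Lemma twist_shift (lambda s : R) (g : R -> X) (t : R) :
  twist lambda (fun r => g (r + s)) t
  = scal (expi (lambda * s) : C_AbsRing) (twist lambda g (t + s)).
Proof.
unfold twist; rewrite scal_assoc; f_equal.
change (expi (- (lambda * t)) = expi (lambda * s) * expi (- (lambda * (t + s))))%C.
rewrite -expi_add; f_equal; ring.
Qed.

Lemma BUC_twist (lambda : R) (g : R -> X) : BUC g -> BUC (twist lambda g).
Proof.
intros [[M H] U]; split.
- exists M; intros t; unfold twist; rewrite norm_expi_scal; apply H.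
- intros e; destruct (U (pos_div_2 e)) as [d hd].
  assert (hM : 0 <= M) by exact (Rle_trans _ _ _ (norm_ge_0 _) (H 0)).
  (* The phase factor varies by at most [2 * Rabs lambda * Rabs (s - t)] and multiplies a value of
     norm at most [M]; the 1 keeps the divisor positive. *)
  assert (hK : 0 < 2 * Rabs lambda * M + 1)
    by (generalize (Rmult_le_pos _ _ (Rabs_pos lambda) hM); lra).
  assert (hd' : 0 < e / 2 / (2 * Rabs lambda * M + 1))
    by (apply Rdiv_lt_0_compat; [generalize (cond_pos e); lra | exact hK]).
  exists (mkposreal _ (Rmin_stable_in_posreal d (mkposreal _ hd'))); simpl.
  intros s t hst; unfold twist.
  assert (h1 := hd s t (Rlt_le_trans _ _ _ hst (Rmin_l _ _))); simpl in h1.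
  assert (h2 := Rlt_le_trans _ _ _ hst (Rmin_r _ _)).
  refine (Rle_lt_trans _ _ _
    (dist_triangle (scal (expi (- (lambda * s)) : C_AbsRing) (g t)) _ _) _).
  rewrite -scal_minus_distr_l norm_expi_scal -scal_minus_distr_r norm_cscal.
  assert (h3 : Cmod (expi (- (lambda * s)) - expi (- (lambda * t)))
    * norm (g t) <= (2 * Rabs lambda * M + 1) * Rabs (s - t)).
    refine (Rle_trans _ _ _ (Rmult_le_compat _ _ _ _ (Cmod_ge_0 _)
      (norm_ge_0 _) (expi_lipschitz _ _) (H t)) _).
    replace (- (lambda * s) - - (lambda * t)) with (- (lambda * (s - t))) by ring.
    rewrite Rabs_Ropp Rabs_mult; generalize (Rabs_pos (s - t)); lra.
  apply (Rmult_lt_compat_l _ _ _ hK) in h2.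
  replace ((2 * Rabs lambda * M + 1) * (e / 2 / (2 * Rabs lambda * M + 1)))
    with (e / 2) in h2 by (field; lra).
  rewrite -(Rplus_half_diag e); apply Rplus_lt_compat; [exact h1|].
  exact (Rle_lt_trans _ _ _ h3 h2).
Qed.

Lemma norm_le_sup_norm (g : R -> X) (t : R) : BUC g -> norm (g t) <= sup_norm g.
Proof.
intros [[M H] _]; unfold sup_norm.
destruct (Lub_Rbar_correct (fun r => exists t : R, r = norm (g t))) as [h1 h2].
(* Boundedness excludes [p_infty], which [real] would send to 0. *)
assert (h3 : Rbar_le (Lub_Rbar (fun r => exists t : R, r = norm (g t))) M)
  by (apply h2; intros r [s ->]; apply H).
specialize (h1 _ (ex_intro _ t eq_refl)).
destruct (Lub_Rbar _); simpl in *; tauto.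
Qed.

Lemma sup_norm_le (g : R -> X) (M : R) :
  (forall t, norm (g t) <= M) -> sup_norm g <= M.
Proof.
intros H; unfold sup_norm.
destruct (Lub_Rbar_correct (fun r => exists t : R, r = norm (g t))) as [h1 h2].
assert (h3 : Rbar_le (Lub_Rbar (fun r => exists t : R, r = norm (g t))) M)
  by (apply h2; intros r [s ->]; apply H).
(* The value at 0 makes the set nonempty, which excludes [m_infty]. *)
specialize (h1 _ (ex_intro _ 0 eq_refl)).
destruct (Lub_Rbar _); simpl in *; tauto.
Qed.

(** Turns the operator bound into a pointwise one free of [sup_norm]. The given constant may be
    negative, hence the absolute value. *)
Lemma bounded_linear_bound (B : (R -> X) -> R -> X) :
  bounded_linear_on_BUC B ->
  exists M, 0 <= M /\ forall g K, BUC g -> (forall t, norm (g t) <= K) ->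
    forall t, norm (B g t) <= M * K.
Proof.
intros (HB & _ & _ & M & HM); exists (Rabs M); split; [apply Rabs_pos|].
intros g K hg hK t.
refine (Rle_trans _ _ _ (norm_le_sup_norm _ t (HB g hg)) _).
refine (Rle_trans _ _ _ (HM g hg) _).
assert (h0 := Rle_trans _ _ _ (norm_ge_0 _) (norm_le_sup_norm g 0 hg)).
assert (h1 := sup_norm_le g K hK).
apply Rle_trans with (Rabs M * sup_norm g).
- apply Rmult_le_compat_r; [exact h0 | apply Rle_abs].
- apply Rmult_le_compat_l; [apply Rabs_pos | exact h1].
Qed.

Lemma bounded_linear_minus (B : (R -> X) -> R -> X) (g h : R -> X) :
  bounded_linear_on_BUC B -> BUC g -> BUC h ->
  B (fun t => minus (g t) (h t)) = (fun t => minus (B g t) (B h t)).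
Proof.
intros (_ & HP & HS & _) hg hh.
assert (E : forall a b : R -> X, (fun t => minus (a t) (b t))
    = (fun t => plus (a t) (scal (RtoC (-1) : C_AbsRing) (b t))))
  by (intros a b; apply functional_extensionality; intros t; apply minus_cscal).
rewrite (E g h) (E (B g) (B h)) (HP g _ hg (BUC_scal (RtoC (-1)) h hh)).
now rewrite (HS (RtoC (-1)) h hh).
Qed.

End BoundedUniformlyContinuous.

(** * Riemann sums as combinations of translates *)

Section RiemannSums.

Context {X : CompleteNormedModule C_AbsRing}.

Fixpoint vsum (x : nat -> X) (n : nat) : X :=
  match n with O => zero | S m => plus (vsum x m) (x m) end.

(** The argument [t j + s] makes each term a multiple of [translate (t j) g] up to conversion. *)
Definition comb (c : nat -> C) (t : nat -> R) (n : nat) (g : R -> X) : R -> X :=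
  fun s => vsum (fun j => scal (c j : C_AbsRing) (g (t j + s))) n.

Lemma riemann_approx (g : R -> X) (a h eta : R) (n : nat) :
  cts g -> 0 <= h ->
  (forall s t, Rabs (s - t) <= h -> norm (minus (g s) (g t)) <= eta) ->
  norm (minus (integ g a (a + INR n * h))
    (vsum (fun j => scal (RtoC h : C_AbsRing) (g (a + INR j * h))) n))
    <= INR n * h * eta.
Proof.
intros hg hh H; induction n as [|n IH].
  simpl; rewrite !Rmult_0_l Rplus_0_r integ_point minus_eq_zero norm_zero_eq.
  apply Rle_refl.
rewrite S_INR; cbn [vsum].
rewrite -(integ_Chasles g a (a + INR n * h) _ hg).
refine (Rle_trans _ _ _ (dist_plus _ _ _ _) _).
replace ((INR n + 1) * h * eta) with (INR n * h * eta + h * eta) by ring.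
apply Rplus_le_compat; [exact IH|].
(* The new term of the sum is the integral of a constant over the new subinterval, so the two are
   compared under the integral. *)
assert (E := integ_const (g (a + INR n * h)) (a + INR n * h) (a + (INR n + 1) * h)).
replace (a + (INR n + 1) * h - (a + INR n * h)) with h in E by ring.
rewrite -E.
apply Rle_trans with ((a + (INR n + 1) * h - (a + INR n * h)) * eta);
  [|right; ring].
apply integ_dist; [exact hg | intros t; apply continuous_const | lra |].
intros t ht; apply H, Rabs_le; lra.
Qed.

Definition riemann_node (a b : R) (N j : nat) : R := a + INR j * ((b - a) / INR N).

(** Mesh times phase at the node. These weights do not depend on the translation [s], so one [comb]
    serves all translates of [g]. *)
Definition riemann_coef (lambda a b : R) (N j : nat) : C :=
  (RtoC ((b - a) / INR N) * expi (- (lambda * riemann_node a b N j)))%C.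

(** [N0] is chosen before [s]: the approximation is uniform over all translates and hence controls
    the sup norm of [comb]. *)
Lemma comb_approx (lambda a b : R) (g : R -> X) (eps : R) :
  BUC g -> a <= b -> 0 < eps ->
  exists N0, forall N, (N0 < N)%nat -> forall s,
    norm (minus (integ (twist lambda (fun t => g (t + s))) a b)
      (comb (riemann_coef lambda a b N) (riemann_node a b N) N g s)) <= eps.
Proof.
intros hg hab heps.
(* The added 1 covers the degenerate interval [a = b]. *)
assert (hba : 0 < b - a + 1) by lra.
assert (heta : 0 < eps / (b - a + 1)) by (apply Rdiv_lt_0_compat; assumption).
(* [twist lambda (g (. + s))] is [twist lambda g] shifted by [s], up to a phase,
   so one modulus of continuity serves all [s]. *)
destruct (BUC_twist lambda g hg) as [_ U].
destruct (U (mkposreal _ heta)) as [d hd]; simpl in hd.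
(* Any [N] above this floor makes the mesh smaller than [d]. *)
destruct (nfloor_ex ((b - a) / d)) as [N0 [_ hN0]].
  apply Rdiv_le_0_compat; [lra | apply cond_pos].
exists N0; intros N hN s.
assert (hN' : (b - a) / d < INR N).
  apply (Rlt_le_trans _ _ _ hN0).
  rewrite -S_INR; apply le_INR, hN.
assert (hNpos : 0 < INR N) by (apply lt_0_INR; lia).
assert (hstep : 0 <= (b - a) / INR N) by (apply Rdiv_le_0_compat; lra).
assert (hstep' : (b - a) / INR N < d).
  apply (Rmult_lt_reg_r (INR N)); [exact hNpos|].
  replace ((b - a) / INR N * INR N) with (b - a) by (field; lra).
  apply (Rmult_lt_compat_r d) in hN'; [|apply cond_pos].
  replace ((b - a) / d * d) with (b - a) in hN'
    by (field; generalize (cond_pos d); lra).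
  lra.
assert (R := riemann_approx (twist lambda (fun t => g (t + s))) a
  ((b - a) / INR N) (eps / (b - a + 1)) N).
assert (E : a + INR N * ((b - a) / INR N) = b) by (field; lra).
rewrite E in R.
replace (INR N * ((b - a) / INR N) * (eps / (b - a + 1)))
  with ((b - a) * (eps / (b - a + 1))) in R by (field; lra).
apply Rle_trans with ((b - a) * (eps / (b - a + 1))).
2:{ replace eps with ((b - a + 1) * (eps / (b - a + 1))) at 2 by (field; lra).
    apply Rmult_le_compat_r; lra. }
assert (E2 : comb (riemann_coef lambda a b N) (riemann_node a b N) N g s =
  vsum (fun j => scal (RtoC ((b - a) / INR N) : C_AbsRing)
    (twist lambda (fun t => g (t + s)) (a + INR j * ((b - a) / INR N)))) N).
  unfold comb; f_equal; apply functional_extensionality; intros j.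
  unfold twist; rewrite scal_assoc; reflexivity.
rewrite E2; apply R.
- apply BUC_cts, BUC_twist.
  replace (fun t => g (t + s)) with (translate s g); [now apply BUC_translate|].
  apply functional_extensionality; intros t; unfold translate; f_equal; ring.
- exact hstep.
- intros p q hpq; left.
  specialize (hd (p + s) (q + s)).
  replace (p + s - (q + s)) with (p - q) in hd by ring.
  specialize (hd (Rle_lt_trans _ _ _ hpq hstep')).
  now rewrite !twist_shift -scal_minus_distr_l norm_expi_scal.
Qed.

End RiemannSums.

(** * Closed operators and integration *)

Section ClosedOperators.

Context {X : CompleteNormedModule C_AbsRing}.

Definition linear_operator (D : X -> Prop) (A : X -> X) : Prop :=
  D zero /\
  (forall x y, D x -> D y -> D (plus x y) /\ A (plus x y) = plus (A x) (A y)) /\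
  (forall (c : C) x, D x ->
     D (scal (c : C_AbsRing) x) /\
     A (scal (c : C_AbsRing) x) = scal (c : C_AbsRing) (A x)).

(** Closedness in approximation form, as the later limit arguments use it. It can also be checked
    directly for the scalar multiplication that replaces [A] in [integ_scal]. *)
Definition graph_closed (D : X -> Prop) (A : X -> X) : Prop :=
  forall x y,
    (forall eps, 0 < eps -> exists p, D p /\ norm (minus p x) <= eps /\
       norm (minus (A p) y) <= eps) ->
    D x /\ A x = y.

Lemma closed_linear_operator_linear (D : X -> Prop) (A : X -> X) :
  closed_linear_operator D A -> linear_operator D A.
Proof. now intros (h1 & h2 & h3 & _). Qed.

Lemma closed_linear_operator_graph (D : X -> Prop) (A : X -> X) :
  closed_linear_operator D A -> graph_closed D A.
Proof.
intros (_ & _ & _ & HC) x y H.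
assert (E : D x /\ y = A x).
  (* [closed] requires only that no neighbourhood of the point misses the graph; a ball of radius
     [e] missing it is refuted at scale [e / 2]. *)
  apply (HC (x, y)); intros [e he].
  destruct (H (e / 2)) as (p & hp & h1 & h2).
    generalize (cond_pos e); lra.
  assert (he2 : e / 2 < e) by (generalize (cond_pos e); lra).
  apply (he (p, A p)); [|split; auto].
  split; simpl.
  - exact (norm_compat1 (V := X) x p e (Rle_lt_trans _ _ _ h1 he2)).
  - exact (norm_compat1 (V := X) y (A p) e (Rle_lt_trans _ _ _ h2 he2)).
destruct E; auto.
Qed.

Lemma linear_operator_zero (D : X -> Prop) (A : X -> X) :
  linear_operator D A -> A zero = zero.
Proof.
intros (h0 & _ & hs).
destruct (hs (RtoC 0) zero h0) as [_ E].
assert (F : forall x : X, scal (RtoC 0 : C_AbsRing) x = zero)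
  by (intros x; apply (scal_zero_l (K := C_Ring))).
now rewrite !F in E.
Qed.

Lemma linear_operator_comb (D : X -> Prop) (A : X -> X) (u v : R -> X)
    (c : nat -> C) (t : nat -> R) (n : nat) (s : R) :
  linear_operator D A -> (forall r, D (u r) /\ v r = A (u r)) ->
  D (comb c t n u s) /\ A (comb c t n u s) = comb c t n v s.
Proof.
intros HL Huv; generalize (linear_operator_zero _ _ HL); intros A0.
destruct HL as (h0 & hp & hs).
induction n as [|n [ID IE]]; [split; assumption|].
destruct (Huv (t n + s)) as [Du Eu].
destruct (hs (c n) _ Du) as [Ds Es].
destruct (hp _ _ ID Ds) as [Dp Ep].
split; [exact Dp|].
unfold comb in *; cbn [vsum]; rewrite Ep IE Es Eu; reflexivity.
Qed.

(** Specialises [comb_approx] to ordinary Riemann sums. *)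
Lemma twist_0 (g : R -> X) : twist 0 (fun t => g (t + 0)) = g.
Proof.
apply functional_extensionality; intros t; unfold twist.
rewrite Rmult_0_l Ropp_0 expi_0 Rplus_0_r; apply (scal_one (K := C_Ring)).
Qed.

(** By linearity [A] maps the Riemann sums of [u] to those of [v]; both converge, and the closed
    graph passes to the limit. *)
Lemma closed_operator_integ (D : X -> Prop) (A : X -> X) (u v : R -> X)
    (a b : R) :
  linear_operator D A -> graph_closed D A -> BUC u -> BUC v -> a <= b ->
  (forall t, D (u t) /\ v t = A (u t)) ->
  D (integ u a b) /\ A (integ u a b) = integ v a b.
Proof.
intros HL HC hu hv hab Huv; apply HC; intros eps heps.
destruct (comb_approx 0 a b u eps hu hab heps) as [N1 h1].
destruct (comb_approx 0 a b v eps hv hab heps) as [N2 h2].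
set (N := S (max N1 N2)).
specialize (h1 N ltac:(lia) 0); specialize (h2 N ltac:(lia) 0).
rewrite twist_0 in h1; rewrite twist_0 in h2.
destruct (linear_operator_comb D A u v (riemann_coef 0 a b N)
  (riemann_node a b N) N 0 HL Huv) as [hD hE].
exists (comb (riemann_coef 0 a b N) (riemann_node a b N) N u 0).
rewrite hE norm_minus_sym (norm_minus_sym _ (integ v a b)); auto.
Qed.

(** The integral lives over [realify X], which yields real homogeneity only. Multiplication by [c]
    is an everywhere defined closed operator, so [closed_operator_integ] applies to it. *)
Lemma integ_scal (c : C) (g : R -> X) (a b : R) : BUC g -> a <= b ->
  integ (fun t => scal (c : C_AbsRing) (g t)) a b
  = scal (c : C_AbsRing) (integ g a b).
Proof.
intros hg hab; symmetry.
apply (closed_operator_integ (fun _ => True) (fun x => scal (c : C_AbsRing) x)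
  g (fun t => scal (c : C_AbsRing) (g t))); auto using BUC_scal.
- repeat split; intros.
  + exact (scal_distr_l (V := X) (c : C_AbsRing) x y).
  + rewrite !scal_assoc; f_equal; apply (Cmult_comm c).
- intros x y H; split; auto.
  apply (dist_zero_of_eps _ _ (Cmod c + 1)); intros eps heps.
  destruct (H eps heps) as (p & _ & h1 & h2).
  refine (Rle_trans _ _ _ (dist_triangle (scal (c : C_AbsRing) p) _ _) _).
  rewrite -scal_minus_distr_l norm_cscal (norm_minus_sym x p); cbv beta in h2.
  generalize (Rmult_le_compat_l _ _ _ (Cmod_ge_0 c) h1); lra.
Qed.

End ClosedOperators.

(** * The integrated equation and its stability properties *)

Section IntegratedEquation.

Context {X : CompleteNormedModule C_AbsRing}.
Variables (D : X -> Prop) (A : X -> X) (B : (R -> X) -> R -> X).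
Hypotheses (HD : closed_linear_operator D A) (HB : bounded_linear_on_BUC B)
  (HT : autonomous B).

(** The equation integrated over [[x, y]] and solved for the [A] term. No derivative appears, so it
    survives uniform limits. *)
Definition integrated_solution (f u : R -> X) : Prop :=
  forall x y, x <= y ->
    D (integ u x y) /\
    A (integ u x y)
    = minus (minus (u y) (u x)) (plus (integ (B u) x y) (integ f x y)).

Lemma BUC_B (g : R -> X) : BUC g -> BUC (B g).
Proof. apply HB. Qed.

Lemma integ_zero (x y : R) : x <= y -> integ (fun _ => zero : X) x y = zero.
Proof.
intros h; apply norm_le_zero.
apply Rle_trans with ((y - x) * 0); [|right; ring].
apply integ_bound; [apply BUC_cts, BUC_zero | exact h |].
intros t _; rewrite norm_zero_eq; apply Rle_refl.
Qed.

(** The equation identifies [A (u t)] with the [BUC] function [du - (B u + f)], so [A] moves out of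
    the integral; the fundamental theorem of calculus evaluates the integral of [du]. *)
Lemma classical_integrated_solution (f u : R -> X) : BUC f ->
  classical_solution D A B f u -> integrated_solution f u.
Proof.
intros hf [hu [du [hdu H]]] x y hxy.
assert (hBu := BUC_B u hu).
assert (E : integ du x y = minus (u y) (u x)).
  apply (is_RInt_unique (V := realify X)).
  apply (is_RInt_derive (V := realify X)).
  - intros t _; apply H.
  - intros t _; apply (BUC_cts du hdu).
assert (hBf : BUC (fun t => plus (B u t) (f t))) by now apply BUC_plus.
rewrite -E -(integ_plus _ _ _ _ (BUC_cts _ hBu) (BUC_cts _ hf)).
rewrite -(integ_minus _ _ _ _ (BUC_cts _ hdu) (BUC_cts _ hBf)).
apply closed_operator_integ; auto using closed_linear_operator_linear,
  closed_linear_operator_graph, BUC_minus.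
intros t; destruct (H t) as (_ & hD & ->); split; [exact hD|].
rewrite -plus_assoc; apply minus_plus_l.
Qed.

Lemma integrated_solution_limit (f u : R -> X) : BUC f -> BUC u ->
  (forall eps, 0 < eps -> exists f' u', BUC f' /\ BUC u' /\
     integrated_solution f' u' /\
     (forall t, norm (minus (f' t) (f t)) <= eps) /\
     (forall t, norm (minus (u' t) (u t)) <= eps)) ->
  integrated_solution f u.
Proof.
intros hf hu H x y hxy; apply (closed_linear_operator_graph D A HD).
destruct (bounded_linear_bound B HB) as (M & hM & HM).
intros eps heps.
(* Total of the errors per unit of [d]: 2 for the end values of [u], [(y - x) * M] for [B u], and
   [y - x] for each of the integrals of [f] and [u]. *)
set (K := 2 + (y - x) * (M + 2)).
assert (hxy0 : 0 <= y - x) by lra.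
assert (hK0 := Rmult_le_pos _ _ hxy0 hM).
assert (hK : 0 < K) by (unfold K; lra).
assert (he : 0 < eps / K) by (apply Rdiv_lt_0_compat; lra).
destruct (H (eps / K) he) as (f' & u' & hf' & hu' & hI & h1 & h2).
destruct (hI x y hxy) as [hD hA].
assert (Ee : eps = K * (eps / K)) by (field; lra).
set (d := eps / K) in *; clearbody d.
assert (hB : forall t, norm (minus (B u' t) (B u t)) <= M * d).
  generalize (HM _ d (BUC_minus u' u hu' hu) h2).
  now rewrite (bounded_linear_minus B u' u HB hu' hu).
assert (hMd : 0 <= (y - x) * (M * d)) by (apply Rmult_le_pos; [|apply Rmult_le_pos]; lra).
assert (hyd : 0 <= (y - x) * d) by (apply Rmult_le_pos; lra).
exists (integ u' x y); split; [exact hD|]; rewrite hA; split.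
- refine (Rle_trans _ _ _ (integ_dist u' u x y d (BUC_cts _ hu') (BUC_cts _ hu)
    hxy (fun t _ => h2 t)) _).
  rewrite Ee; unfold K; lra.
- refine (Rle_trans _ _ _ (dist_minus _ _ _ _) _).
  refine (Rle_trans _ _ _ (Rplus_le_compat _ _ _ _ (dist_minus _ _ _ _)
    (dist_plus _ _ _ _)) _).
  generalize (h2 y) (h2 x)
   (integ_dist (B u') (B u) x y (M * d) (BUC_cts _ (BUC_B _ hu'))
    (BUC_cts _ (BUC_B _ hu)) hxy (fun t _ => hB t))
   (integ_dist f' f x y d (BUC_cts _ hf') (BUC_cts _ hf) hxy (fun t _ => h1 t)).
  rewrite Ee; unfold K; lra.
Qed.

Lemma strong_mild_integrated_solution (f u : R -> X) :
  strong_mild_solution D A B f u -> integrated_solution f u.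
Proof.
intros (hf & hu & fn & un & hn & hu0 & hf0).
apply integrated_solution_limit; auto; intros eps heps.
apply is_lim_seq_spec in hu0; apply is_lim_seq_spec in hf0.
destruct (hu0 (mkposreal eps heps)) as [N1 h1].
destruct (hf0 (mkposreal eps heps)) as [N2 h2].
set (N := max N1 N2).
specialize (h1 N ltac:(lia)); specialize (h2 N ltac:(lia)); simpl in h1, h2.
destruct (hn N) as [hfN hcN].
assert (huN : BUC (un N)) by apply hcN.
exists (fn N), (un N); split; [exact hfN | split; [exact huN | split; [|split]]].
- now apply classical_integrated_solution.
- intros t; rewrite Rminus_0_r in h2.
  refine (Rle_trans _ _ _ (norm_le_sup_norm _ t (BUC_minus _ _ hfN hf)) _).
  left; exact (Rle_lt_trans _ _ _ (Rle_abs _) h2).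
- intros t; rewrite Rminus_0_r in h1.
  refine (Rle_trans _ _ _ (norm_le_sup_norm _ t (BUC_minus _ _ huN hu)) _).
  left; exact (Rle_lt_trans _ _ _ (Rle_abs _) h1).
Qed.

Lemma integrated_solution_plus (f g u v : R -> X) :
  BUC f -> BUC g -> BUC u -> BUC v ->
  integrated_solution f u -> integrated_solution g v ->
  integrated_solution (fun t => plus (f t) (g t)) (fun t => plus (u t) (v t)).
Proof.
intros hf hg hu hv Hu Hv x y hxy.
destruct (Hu x y hxy) as [D1 E1]; destruct (Hv x y hxy) as [D2 E2].
destruct HD as (_ & hp & _); destruct (hp _ _ D1 D2) as [D3 E3].
destruct HB as (_ & hBp & _); rewrite (hBp u v hu hv).
rewrite !integ_plus; auto using BUC_cts, BUC_B.
split; [exact D3|]; rewrite E3 E1 E2.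
now rewrite (plus_plus_swap (integ (B u) x y)) !minus_plus_plus.
Qed.

Lemma integrated_solution_scal (c : C) (f u : R -> X) :
  BUC f -> BUC u -> integrated_solution f u ->
  integrated_solution (fun t => scal (c : C_AbsRing) (f t))
    (fun t => scal (c : C_AbsRing) (u t)).
Proof.
intros hf hu Hu x y hxy.
destruct (Hu x y hxy) as [D1 E1].
destruct HD as (_ & _ & hs & _); destruct (hs c _ D1) as [D3 E3].
destruct HB as (_ & _ & hBs & _); rewrite (hBs c u hu).
rewrite (integ_scal c u x y hu hxy) (integ_scal c f x y hf hxy).
rewrite (integ_scal c (B u) x y (BUC_B u hu) hxy).
split; [exact D3|].
rewrite E3 E1 !scal_minus_distr_l scal_distr_l; reflexivity.
Qed.

Lemma integ_translate (s : R) (g : R -> X) (x y : R) : BUC g ->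
  integ (translate s g) x y = integ g (s + x) (s + y).
Proof.
intros hg; rewrite (Rplus_comm s x) (Rplus_comm s y) -integ_shift.
- f_equal; apply functional_extensionality; intros t.
  unfold translate; f_equal; ring.
- now apply BUC_cts.
Qed.

(** Autonomy of [B] enters here: the relation for the translates on [[x, y]] is the original one on
    [[s + x, s + y]]. *)
Lemma integrated_solution_translate (s : R) (f u : R -> X) :
  BUC f -> BUC u -> integrated_solution f u ->
  integrated_solution (translate s f) (translate s u).
Proof.
intros hf hu Hu x y hxy.
rewrite (HT s u hu) !integ_translate; auto using BUC_B.
apply Hu; lra.
Qed.

Lemma integrated_solution_zero :
  integrated_solution (fun _ => zero) (fun _ => zero).
Proof.
intros x y hxy.
assert (E : B (fun _ => zero) = (fun _ => zero)).
  destruct HB as (_ & _ & hBs & _).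
  generalize (hBs (RtoC 0) _ (BUC_zero (X := X))).
  assert (F : forall g : R -> X,
    (fun t => scal (RtoC 0 : C_AbsRing) (g t)) = (fun _ => zero)).
    intros g; apply functional_extensionality; intros t.
    apply (scal_zero_l (K := C_Ring)).
  now rewrite !F.
rewrite E (integ_zero x y hxy).
split; [apply HD|].
rewrite (linear_operator_zero D A (closed_linear_operator_linear D A HD)).
rewrite plus_zero_r !minus_eq_zero; reflexivity.
Qed.

Lemma integrated_solution_comb (f u : R -> X) (c : nat -> C) (t : nat -> R)
    (n : nat) :
  BUC f -> BUC u -> integrated_solution f u ->
  BUC (comb c t n f) /\ BUC (comb c t n u) /\
  integrated_solution (comb c t n f) (comb c t n u).
Proof.
intros hf hu H; induction n as [|n (If & Iu & II)].
  split; [|split]; [apply BUC_zero | apply BUC_zero |].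
  exact integrated_solution_zero.
assert (tf := BUC_translate (t n) f hf); assert (tu := BUC_translate (t n) u hu).
assert (sf := BUC_scal (c n) _ tf); assert (su := BUC_scal (c n) _ tu).
split; [|split].
- exact (BUC_plus _ _ If sf).
- exact (BUC_plus _ _ Iu su).
- apply (integrated_solution_plus _ _ _ _ If sf Iu su II).
  now apply integrated_solution_scal, integrated_solution_translate.
Qed.

End IntegratedEquation.

(** * Existence of means over symmetric windows *)

Section Means.

Context {X : CompleteNormedModule C_AbsRing}.

Notation rscal := (realify_scal X).

Lemma norm_rscal (r : R) (x : X) : norm (rscal r x) = Rabs r * norm x.
Proof. unfold realify_scal; rewrite norm_cscal Cmod_R; reflexivity. Qed.

Lemma rscal_minus (r : R) (x y : X) :
  rscal r (minus x y) = minus (rscal r x) (rscal r y).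
Proof. exact (scal_minus_distr_l (V := X) (RtoC r : C_AbsRing) x y). Qed.

Lemma rscal_sub (r s : R) (x : X) :
  minus (rscal r x) (rscal s x) = rscal (r - s) x.
Proof.
unfold realify_scal; rewrite -scal_minus_distr_r; f_equal.
now rewrite RtoC_minus.
Qed.

Lemma rscal_cscal (r : R) (c : C) (x : X) :
  rscal r (scal (c : C_AbsRing) x) = scal (c : C_AbsRing) (rscal r x).
Proof.
unfold realify_scal; rewrite !scal_assoc; f_equal; apply (Cmult_comm (RtoC r)).
Qed.

Lemma integ_multiple (h : R -> X) (T d a : R) (n : nat) : cts h ->
  (forall b, norm (minus (integ h b (b + T)) (integ h 0 T)) <= d) ->
  norm (minus (integ h a (a + INR n * T)) (rscal (INR n) (integ h 0 T)))
    <= INR n * d.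
Proof.
intros hh H; induction n as [|n IH].
- simpl; rewrite !Rmult_0_l Rplus_0_r integ_point.
  replace (rscal 0 (integ h 0 T)) with (zero : X).
  + rewrite minus_eq_zero norm_zero_eq; apply Rle_refl.
  + symmetry; exact (scal_zero_l (V := X) (integ h 0 T)).
- rewrite S_INR realify_scal_distr_r realify_scal_one.
  rewrite -(integ_Chasles h a (a + INR n * T) _ hh).
  refine (Rle_trans _ _ _ (dist_plus _ _ _ _) _).
  specialize (H (a + INR n * T)).
  replace (a + INR n * T + T) with (a + (INR n + 1) * T) in H by ring.
  lra.
Qed.

(** Cut [[-S, S]] into [n] windows of length [T] and a shorter remainder. The windows account for
    [eps + C / T]. The remainder, and the gap between [n] and [2 * S / T], each contribute at most
    [T * M] before division by [2 * S]. *)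
Lemma mean_close (h : R -> X) (M T C eps S : R) : cts h ->
  (forall t, norm (h t) <= M) -> 0 < T -> 0 < S -> 0 <= C -> 0 <= eps ->
  (forall a, norm (minus (integ h a (a + T)) (integ h 0 T)) <= eps * T + C) ->
  norm (minus (rscal (/ (2 * S)) (integ h (- S) S)) (rscal (/ T) (integ h 0 T)))
    <= eps + C / T + M * T / S.
Proof.
intros hh HM hT hS hC heps H.
assert (hM : 0 <= M) by exact (Rle_trans _ _ _ (norm_ge_0 _) (HM 0)).
destruct (nfloor_ex (2 * S / T)) as [n [hn1 hn2]].
  apply Rdiv_le_0_compat; lra.
assert (hn1' : INR n * T <= 2 * S).
  apply (Rmult_le_compat_r T) in hn1; [|lra].
  now replace (2 * S / T * T) with (2 * S) in hn1 by (field; lra).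
assert (hn2' : 2 * S < INR n * T + T).
  apply (Rmult_lt_compat_r T) in hn2; [|lra].
  replace (2 * S / T * T) with (2 * S) in hn2 by (field; lra); lra.
set (I0 := integ h 0 T) in *.
assert (hI0 : norm I0 <= T * M).
  unfold I0; replace T with (T - 0) at 2 by ring; apply integ_bound; auto; lra.
assert (h1 := integ_multiple h T (eps * T + C) (- S) n hh H); fold I0 in h1.
assert (h2 : norm (integ h (- S + INR n * T) S) <= T * M).
  refine (Rle_trans _ _ _ (integ_bound h _ S M hh _ (fun t _ => HM t)) _); [lra|].
  apply Rmult_le_compat_r; lra.
assert (h3 : norm (minus (rscal (INR n) I0) (rscal (2 * S / T) I0)) <= T * M).
  rewrite rscal_sub norm_rscal -(Rmult_1_l (T * M)).
  apply Rmult_le_compat; [apply Rabs_pos | apply norm_ge_0 | | exact hI0].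
  apply Rabs_le; lra.
replace (rscal (/ T) I0) with (rscal (/ (2 * S)) (rscal (2 * S / T) I0)).
2:{ rewrite realify_scal_assoc; f_equal; field; lra. }
rewrite -rscal_minus norm_rscal.
assert (hS2 : 0 < / (2 * S)) by (apply Rinv_0_lt_compat; lra).
rewrite (Rabs_pos_eq (/ (2 * S)) (Rlt_le _ _ hS2)).
apply (Rmult_le_reg_l (2 * S)); [lra|].
rewrite -Rmult_assoc Rinv_r; [|lra]; rewrite Rmult_1_l.
assert (h4 : INR n * (eps * T + C) <= 2 * S * (eps + C / T)).
  replace (INR n * (eps * T + C)) with (INR n * T * (eps + C / T)) by (field; lra).
  apply Rmult_le_compat_r; [|exact hn1'].
  generalize (Rdiv_le_0_compat C T hC hT); lra.
replace (2 * S * (eps + C / T + M * T / S))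
  with (2 * S * (eps + C / T) + T * M + T * M) by (field; lra).
rewrite -(integ_Chasles h (- S) (- S + INR n * T) S hh).
refine (Rle_trans _ _ _ (dist_triangle (rscal (INR n) I0) _ _) _).
apply Rplus_le_compat; [|exact h3].
rewrite -{1}(plus_zero_r (rscal (INR n) I0)).
refine (Rle_trans _ _ _ (dist_plus _ _ _ _) _).
rewrite minus_zero_r; lra.
Qed.

(** Cauchy criterion: the means over all long windows lie near the single mean over [[0, T]], for
    one suitably large [T]. *)
Lemma mean_exists (h : R -> X) (M : R) : cts h -> (forall t, norm (h t) <= M) ->
  (forall eps, 0 < eps -> exists C, 0 <= C /\ forall a b, 0 <= b ->
     norm (minus (integ h a (a + b)) (integ h 0 b)) <= eps * b + C) ->
  exists l : X, filterlim (fun T => rscal (/ (2 * T)) (integ h (- T) T))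
    (Rbar_locally p_infty) (locally l).
Proof.
intros hh HM HQ.
apply (filterlim_locally_cauchy (U := X)); intros eps.
assert (hM : 0 <= M) by exact (Rle_trans _ _ _ (norm_ge_0 _) (HM 0)).
assert (he : 0 < eps / 8) by (generalize (cond_pos eps); lra).
destruct (HQ _ he) as (C & hC & H).
(* Makes [C / T] at most [eps / 8]; the 1 keeps [T] positive when [C] is 0. *)
set (T := C / (eps / 8) + 1).
assert (hCe : 0 <= C / (eps / 8)) by (apply Rdiv_le_0_compat; assumption).
assert (hT : 0 < T) by (unfold T; lra).
assert (hCT : C / T <= eps / 8).
  apply (Rmult_le_reg_r T); [exact hT|].
  replace (C / T * T) with (C / (eps / 8) * (eps / 8)) by (field; lra).
  rewrite (Rmult_comm (eps / 8)); apply Rmult_le_compat_r; unfold T; lra.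
assert (hMT : 0 <= M * T / (eps / 8))
  by (apply Rdiv_le_0_compat; [apply Rmult_le_pos; lra | exact he]).
exists (fun S => M * T / (eps / 8) < S); split.
  exists (M * T / (eps / 8)); auto.
assert (K : forall S, M * T / (eps / 8) < S ->
  norm (minus (rscal (/ (2 * S)) (integ h (- S) S)) (rscal (/ T) (integ h 0 T)))
    <= 3 * (eps / 8)).
  intros S hS; assert (hS0 : 0 < S) by lra.
  refine (Rle_trans _ _ _ (mean_close h M T C (eps / 8) S hh HM hT _ hC _
    (fun a => H a T (Rlt_le _ _ hT))) _); try lra.
  assert (M * T / S <= eps / 8); [|lra].
  apply (Rmult_le_reg_r S); [lra|].
  apply (Rmult_lt_compat_r (eps / 8)) in hS; [|exact he].
  replace (M * T / S * S) with (M * T / (eps / 8) * (eps / 8)) by (field; lra).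
  lra.
intros S S' hS hS'; apply (norm_compat1 (V := X)).
refine (Rle_lt_trans _ _ _ (dist_triangle (rscal (/ T) (integ h 0 T)) _ _) _).
rewrite (norm_minus_sym _ (rscal (/ (2 * S)) _)).
generalize (K S hS) (K S' hS'); lra.
Qed.

End Means.

(** * Twisted means of almost periodic functions *)

Section AlmostPeriodicMeans.

Context {X : CompleteNormedModule C_AbsRing}.

Notation rscal := (realify_scal X).

Lemma BUC_shift (s : R) (g : R -> X) : BUC g -> BUC (fun t => g (t + s)).
Proof.
intros hg; replace (fun t => g (t + s)) with (translate s g).
- now apply BUC_translate.
- apply functional_extensionality; intros t; unfold translate; f_equal; ring.
Qed.

Lemma integ_twist_shift (lambda s a b : R) (g : R -> X) : BUC g -> a <= b ->
  integ (twist lambda (fun t => g (t + s))) a b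
  = scal (expi (lambda * s) : C_AbsRing) (integ (twist lambda g) (a + s) (b + s)).
Proof.
intros hg hab.
rewrite -integ_shift; [|now apply BUC_cts, BUC_twist].
rewrite -integ_scal; [| now apply BUC_shift, BUC_twist | exact hab].
f_equal; apply functional_extensionality; intros t; apply twist_shift.
Qed.

Lemma integ_twist_almost_period (lambda tau eps a b : R) (g : R -> X) :
  BUC g -> a <= b -> (forall t, norm (minus (g (t + tau)) (g t)) <= eps) ->
  norm (minus (integ (twist lambda (fun t => g (t + tau))) a b)
    (integ (twist lambda g) a b)) <= (b - a) * eps.
Proof.
intros hg hab H; apply integ_dist; try exact hab.
- now apply BUC_cts, BUC_twist, BUC_shift.
- now apply BUC_cts, BUC_twist.
- intros t _; unfold twist; rewrite -scal_minus_distr_l norm_expi_scal; apply H.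
Qed.

(* Translating by an [eps]-almost period moves any [s] into a bounded window, so
   the twisted means of the translates of [g] are controlled uniformly in [s]. *)
Lemma integ_twist_uniform (lambda M eps : R) (g : R -> X) :
  BUC g -> almost_periodic g -> (forall t, norm (g t) <= M) -> 0 < eps ->
  exists L, 0 <= L /\ forall T s, 0 <= T ->
    norm (integ (twist lambda (fun t => g (t + s))) (- T) T)
    <= 2 * T * eps + norm (integ (twist lambda g) (- T) T) + 2 * M * L.
Proof.
intros hg [_ HAP] HM heps.
assert (hM : 0 <= M) by exact (Rle_trans _ _ _ (norm_ge_0 _) (HM 0)).
destruct (HAP (mkposreal eps heps)) as (L & hL & H); simpl in H.
exists L; split; [lra|]; intros T s hT.
(* This almost period puts [tau + s] in [[0, L]]. *)
destruct (H (- s)) as (tau & htau & Htau).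
assert (hTT : - T <= T) by lra.
assert (h1 := integ_twist_almost_period lambda tau eps (- T) T
  (fun t => g (t + s)) (BUC_shift s g hg) hTT).
cbv beta in h1.
replace (fun t => g (t + tau + s)) with (fun t => g (t + (tau + s))) in h1.
2:{ apply functional_extensionality; intros t; f_equal; ring. }
rewrite (integ_twist_shift lambda (tau + s) (- T) T g hg hTT) in h1.
assert (h2 := integ_window (twist lambda g) (- T) T (tau + s) M
  (BUC_cts _ (BUC_twist lambda g hg))).
assert (HM' : forall t, norm (twist lambda g t) <= M)
  by (intros t; unfold twist; rewrite norm_expi_scal; apply HM).
specialize (h2 HM').
assert (h3 : 2 * M * Rabs (tau + s) <= 2 * M * L)
  by (apply Rmult_le_compat_l; [lra | apply Rabs_le; lra]).
refine (Rle_trans _ _ _ (norm_le_dist _ (scal (expi (lambda * (tau + s)) : C_AbsRing)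
    (integ (twist lambda g) (- T + (tau + s)) (T + (tau + s))))) _).
rewrite norm_minus_sym norm_expi_scal.
assert (h4 := norm_le_dist (integ (twist lambda g) (- T + (tau + s)) (T + (tau + s)))
  (integ (twist lambda g) (- T) T)).
assert (h5 : forall t, norm (minus (g (t + (tau + s))) (g (t + s))) <= eps).
  intros t; replace (t + (tau + s)) with (t + s + tau) by ring; apply Htau.
specialize (h1 (fun t => ltac:(rewrite (Rplus_assoc t tau s); apply h5))).
lra.
Qed.

Lemma norm_expi_scal_minus (theta : R) (x : X) :
  norm (minus (scal (expi theta : C_AbsRing) x) x)
  = Cmod (expi theta - 1) * norm x.
Proof.
assert (E : minus (scal (expi theta : C_AbsRing) x) x
  = scal ((expi theta - 1)%C : C_AbsRing) x).
  rewrite -{2}(scal_one x) -scal_minus_distr_r; reflexivity.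
rewrite E; apply norm_cscal.
Qed.

(* When the twisted means stay away from 0, every [eps]-almost period [tau] of
   [g] nearly fixes the character: comparing the means of [g] and of its
   translate by [tau] over long windows gives [expi (lambda * tau) ~ 1]. *)
Lemma almost_period_character (lambda M c T0 tau eps : R) (g : R -> X) :
  BUC g -> (forall t, norm (g t) <= M) -> 0 < c -> 0 < T0 -> 0 < eps ->
  (forall T, T0 <= T -> 2 * T * c <= norm (integ (twist lambda g) (- T) T)) ->
  (forall t, norm (minus (g (t + tau)) (g t)) <= eps) ->
  Cmod (expi (lambda * tau) - 1) <= 2 * eps / c.
Proof.
intros hg HM hc hT0 heps H Htau.
assert (hM : 0 <= M) by exact (Rle_trans _ _ _ (norm_ge_0 _) (HM 0)).
(* For so long a window, moving it by [tau] costs at most [2 * T * eps], the same as replacing [g]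
   by its translate. *)
set (T := Rmax T0 (M * Rabs tau / eps)).
assert (hT : T0 <= T) by apply Rmax_l.
assert (hT2 : M * Rabs tau <= T * eps).
  replace (M * Rabs tau) with (M * Rabs tau / eps * eps) by (field; lra).
  apply Rmult_le_compat_r; [lra | apply Rmax_r].
assert (hTT : - T <= T) by lra.
specialize (H T hT).
assert (h1 := integ_twist_almost_period lambda tau eps (- T) T g hg hTT Htau).
rewrite (integ_twist_shift lambda tau (- T) T g hg hTT) in h1.
assert (HM' : forall t, norm (twist lambda g t) <= M)
  by (intros t; unfold twist; rewrite norm_expi_scal; apply HM).
assert (h2 := integ_window (twist lambda g) (- T) T tau M
  (BUC_cts _ (BUC_twist lambda g hg)) HM').
set (K := integ (twist lambda g) (- T) T) in *.
set (K' := integ (twist lambda g) (- T + tau) (T + tau)) in *.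
assert (h3 : Cmod (expi (lambda * tau) - 1) * norm K <= 4 * T * eps).
  rewrite -norm_expi_scal_minus.
  refine (Rle_trans _ _ _
    (dist_triangle (scal (expi (lambda * tau) : C_AbsRing) K') _ _) _).
  rewrite -scal_minus_distr_l norm_expi_scal (norm_minus_sym K K'); lra.
assert (h4 := Rmult_le_compat_l _ _ _ (Cmod_ge_0 (expi (lambda * tau) - 1)) H).
apply (Rmult_le_reg_r (2 * T * c)); [apply Rmult_lt_0_compat; lra|].
replace (2 * eps / c * (2 * T * c)) with (4 * T * eps) by (field; lra).
lra.
Qed.

(** To compare the windows at [a] and at 0, choose an almost period [tau] in [[a, a + L]]. Moving
    from [a] to [tau] costs a constant; the step from [tau] to 0 costs a phase close to 1 and the
    translation error, both small relative to the length. Thus [mean_exists] applies. *)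
Lemma bohr_spectrum_of_lower_bound (lambda c T0 : R) (g : R -> X) :
  BUC g -> almost_periodic g -> 0 < c -> 0 < T0 ->
  (forall T, T0 <= T -> 2 * T * c <= norm (integ (twist lambda g) (- T) T)) ->
  bohr_spectrum g lambda.
Proof.
intros hg HAP hc hT0 H.
destruct (proj1 hg) as [M HM].
assert (hM : 0 <= M) by exact (Rle_trans _ _ _ (norm_ge_0 _) (HM 0)).
assert (hh : cts (twist lambda g)) by now apply BUC_cts, BUC_twist.
assert (HM' : forall t, norm (twist lambda g t) <= M)
  by (intros t; unfold twist; rewrite norm_expi_scal; apply HM).
destruct (mean_exists (twist lambda g) M hh HM') as [l hl].
- intros eps' heps'.
  (* Solves [2 * eps / c * M + eps = eps'], the sum of the phase and translation errors per unit
     length. *)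
  set (eps := eps' * c / (c + 2 * M)).
  assert (heps : 0 < eps)
    by (apply Rdiv_lt_0_compat; [apply Rmult_lt_0_compat|]; lra).
  destruct (proj2 HAP (mkposreal eps heps)) as (L & hL & HL); simpl in HL.
  exists (2 * M * L); split; [apply Rmult_le_pos; lra|].
  intros a b hb.
  destruct (HL a) as (tau & htau & Htau).
  assert (h1 := almost_period_character lambda M c T0 tau eps g hg HM hc hT0
    heps H Htau).
  assert (h2 := integ_twist_almost_period lambda tau eps 0 b g hg hb Htau).
  rewrite (integ_twist_shift lambda tau 0 b g hg hb) Rplus_0_l Rminus_0_r in h2.
  assert (h3 := integ_window (twist lambda g) a (a + b) (tau - a) M hh HM').
  replace (a + (tau - a)) with tau in h3 by ring.
  replace (a + b + (tau - a)) with (b + tau) in h3 by ring.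
  assert (h4 : 2 * M * Rabs (tau - a) <= 2 * M * L)
    by (apply Rmult_le_compat_l; [lra | apply Rabs_le; lra]).
  set (K := integ (twist lambda g) tau (b + tau)) in *.
  assert (hK : norm K <= b * M).
    unfold K; replace b with (b + tau - tau) at 2 by ring.
    apply integ_bound; auto; lra.
  assert (h5 := Rmult_le_compat _ _ _ _ (Cmod_ge_0 _) (norm_ge_0 K) h1 hK).
  rewrite -norm_expi_scal_minus norm_minus_sym in h5.
  refine (Rle_trans _ _ _ (dist_triangle K _ _) _).
  rewrite (norm_minus_sym _ K).
  assert (h6 := dist_triangle (scal (expi (lambda * tau) : C_AbsRing) K) K
    (integ (twist lambda g) 0 b)).
  assert (E : eps' * b = 2 * eps / c * (b * M) + b * eps)
    by (unfold eps; field; lra).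
  lra.
- exists l; split; [exact hl|]; intros ->.
  (* A zero limit would bring the norm of the means below [c] for large [T]. *)
  destruct (hl _ (locally_ball_norm (V := X) zero (mkposreal c hc))) as [T1 hT1].
  set (T := Rmax T1 T0 + 1).
  assert (g1 : T1 < T) by (unfold T; generalize (Rmax_l T1 T0); lra).
  assert (g2 : T0 <= T) by (unfold T; generalize (Rmax_r T1 T0); lra).
  specialize (hT1 T g1); specialize (H T g2).
  unfold ball_norm in hT1; simpl in hT1.
  rewrite minus_zero_r norm_rscal in hT1.
  assert (hT2 : 0 < / (2 * T)) by (apply Rinv_0_lt_compat; lra).
  rewrite (Rabs_pos_eq _ (Rlt_le _ _ hT2)) in hT1.
  apply (Rmult_lt_compat_l (2 * T)) in hT1; [|lra].
  rewrite -Rmult_assoc Rinv_r in hT1; lra.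
Qed.

End AlmostPeriodicMeans.

(** * Inclusion of the Bohr spectra *)

Section Spectrum.

Context {X : CompleteNormedModule C_AbsRing}.
Variables (D : X -> Prop) (A : X -> X) (B : (R -> X) -> R -> X).
Hypotheses (HD : closed_linear_operator D A) (HB : bounded_linear_on_BUC B)
  (HT : autonomous B).

Notation rscal := (realify_scal X).

(** The limit of the averaged translates of [f] when [a] is its Bohr coefficient at [lambda]. *)
Definition character (lambda : R) (a : X) : R -> X :=
  fun s => scal (expi (lambda * s) : C_AbsRing) a.

Lemma BUC_character (lambda : R) (a : X) : BUC (character lambda a).
Proof.
replace (character lambda a) with (twist (- lambda) (fun _ => a)).
- apply BUC_twist; split.
  + exists (norm a); intros _; apply Rle_refl.
  + intros e; exists (mkposreal 1 Rlt_0_1); intros s t _.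
    rewrite minus_eq_zero norm_zero_eq; apply cond_pos.
- apply functional_extensionality; intros s; unfold twist, character.
  f_equal; f_equal; ring.
Qed.

(** The pair consists of the same Riemann sum of averaged translates, applied to [f] and to [u].
    Smallness at one window spreads to all [s] by [integ_twist_uniform]; for [f], restricting [s] to
    [[0, 1]] bounds the shift of the window. *)
Lemma character_approx (lambda : R) (f u : R -> X) (a : X) :
  BUC f -> BUC u -> almost_periodic u -> integrated_solution D A B f u ->
  is_bohr_coef lambda f a ->
  (forall c T0, 0 < c -> 0 < T0 -> exists T, T0 <= T /\
     norm (integ (twist lambda u) (- T) T) < 2 * T * c) ->
  forall eta, 0 < eta -> exists f' u', BUC f' /\ BUC u' /\
    integrated_solution D A B f' u' /\
    (forall s, norm (u' s) <= eta) /\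
    (forall s, 0 <= s <= 1 -> norm (minus (f' s) (character lambda a s)) <= eta).
Proof.
intros hf hu hAP Hfu Ha Hu eta heta.
destruct (proj1 hf) as [Mf HMf]; destruct (proj1 hu) as [Mu HMu].
assert (hMf : 0 <= Mf) by exact (Rle_trans _ _ _ (norm_ge_0 _) (HMf 0)).
assert (hMu : 0 <= Mu) by exact (Rle_trans _ _ _ (norm_ge_0 _) (HMu 0)).
assert (he8 : 0 < eta / 8) by lra.
destruct (integ_twist_uniform lambda Mu (eta / 8) u hu hAP HMu he8)
  as (L & hL & HL).
destruct (Ha _ (locally_ball_norm (V := X) a (mkposreal _ he8))) as [T1 hT1].
assert (hMuL : 0 <= Mu * L) by now apply Rmult_le_pos.
(* Beyond [T1] the mean of [f] is within [eta / 8] of [a]; the last two terms make the boundary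
   errors [Mu * L] and [Mf] at most [T * (eta / 8)]. *)
set (T0 := Rabs T1 + 1 + Mu * L / (eta / 8) + Mf / (eta / 8)).
assert (p1 : 0 <= Mu * L / (eta / 8)) by now apply Rdiv_le_0_compat.
assert (p2 : 0 <= Mf / (eta / 8)) by now apply Rdiv_le_0_compat.
assert (hT0 : 0 < T0) by (unfold T0; generalize (Rabs_pos T1); lra).
destruct (Hu (eta / 8) T0 he8 hT0) as (T & hT & HuT).
assert (hT1T : T1 < T) by (unfold T0 in hT; generalize (Rle_abs T1); lra).
assert (q1 : Mu * L <= T * (eta / 8)).
  replace (Mu * L) with (Mu * L / (eta / 8) * (eta / 8)) by (field; lra).
  apply Rmult_le_compat_r; [lra|]; unfold T0 in hT; generalize (Rabs_pos T1); lra.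
assert (q2 : Mf <= T * (eta / 8)).
  replace Mf with (Mf / (eta / 8) * (eta / 8)) by (field; lra).
  apply Rmult_le_compat_r; [lra|]; unfold T0 in hT; generalize (Rabs_pos T1); lra.
assert (hTpos : 0 < T) by lra.
assert (hTT : - T <= T) by lra.
assert (heps : 0 < 2 * T * (eta / 8)) by (apply Rmult_lt_0_compat; lra).
destruct (comb_approx lambda (- T) T u _ hu hTT heps) as [N1 h1].
destruct (comb_approx lambda (- T) T f _ hf hTT heps) as [N2 h2].
set (N := S (max N1 N2)).
specialize (h1 N ltac:(lia)); specialize (h2 N ltac:(lia)).
set (c := riemann_coef lambda (- T) T N) in *.
set (t := riemann_node (- T) T N) in *.
destruct (integrated_solution_comb D A B HD HB HT f u c t N hf hu Hfu)
  as (If & Iu & II).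
assert (hi : 0 < / (2 * T)) by (apply Rinv_0_lt_compat; lra).
assert (habs := Rabs_pos_eq _ (Rlt_le _ _ hi)).
exists (fun s => rscal (/ (2 * T)) (comb c t N f s)),
  (fun s => rscal (/ (2 * T)) (comb c t N u s)).
split; [now apply BUC_scal | split; [now apply BUC_scal|]].
split; [exact (integrated_solution_scal D A B HD HB _ _ _ If Iu II) | split].
- intros s; rewrite norm_rscal habs.
  apply (Rmult_le_reg_l (2 * T)); [lra|].
  rewrite -Rmult_assoc Rinv_r; [|lra]; rewrite Rmult_1_l.
  refine (Rle_trans _ _ _ (norm_le_dist _
    (integ (twist lambda (fun t => u (t + s))) (- T) T)) _).
  rewrite norm_minus_sym.
  (* Four errors of at most [2 * T * (eta / 8)]: Riemann sum, almost period, mean of [u], window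
     shift. *)
  generalize (h1 s) (HL T s (Rlt_le _ _ hTpos)); nra.
- intros s hs.
  set (K := integ (twist lambda f) (- T) T) in *.
  set (K' := integ (twist lambda f) (- T + s) (T + s)) in *.
  assert (HM' : forall t, norm (twist lambda f t) <= Mf)
    by (intros r; unfold twist; rewrite norm_expi_scal; apply HMf).
  assert (h3 := integ_window (twist lambda f) (- T) T s Mf
    (BUC_cts _ (BUC_twist lambda f hf)) HM').
  fold K K' in h3.
  assert (h4 : 2 * Mf * Rabs s <= 2 * Mf * 1)
    by (apply Rmult_le_compat_l; [lra | apply Rabs_le; lra]).
  specialize (h2 s); rewrite (integ_twist_shift lambda s (- T) T f hf hTT) in h2.
  fold K' in h2.
  assert (h5 : norm (minus (rscal (/ (2 * T)) K) a) < eta / 8)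
    by exact (hT1 T hT1T).
  refine (Rle_trans _ _ _ (dist_triangle (rscal (/ (2 * T))
    (scal (expi (lambda * s) : C_AbsRing) K')) _ _) _).
  rewrite -rscal_minus norm_rscal habs (norm_minus_sym (comb c t N f s)) rscal_cscal.
  unfold character; rewrite -scal_minus_distr_l norm_expi_scal.
  assert (h6 := dist_triangle (rscal (/ (2 * T)) K) (rscal (/ (2 * T)) K') a).
  rewrite -rscal_minus norm_rscal habs in h6.
  apply (Rmult_le_compat_l _ _ _ (Rlt_le _ _ hi)) in h2.
  assert (h7 : norm (minus K' K) <= 2 * T * (eta / 8)) by lra.
  apply (Rmult_le_compat_l _ _ _ (Rlt_le _ _ hi)) in h7.
  replace (/ (2 * T) * (2 * T * (eta / 8))) with (eta / 8) in h2, h7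
    by (field; lra).
  apply Rle_trans with (eta / 8 + (eta / 8 + eta / 8)); [|lra].
  apply Rplus_le_compat; [exact h2|].
  refine (Rle_trans _ _ _ h6 _).
  apply Rplus_le_compat; [exact h7 | left; exact h5].
Qed.

(* Applied to ever better approximations of the pair (0, character), closedness
   of [A] yields [A 0 = - integral of the character]. *)
Lemma integ_character_zero (lambda y : R) (a : X) : 0 <= y <= 1 ->
  (forall eta, 0 < eta -> exists f' u', BUC f' /\ BUC u' /\
    integrated_solution D A B f' u' /\
    (forall s, norm (u' s) <= eta) /\
    (forall s, 0 <= s <= 1 -> norm (minus (f' s) (character lambda a s)) <= eta)) ->
  integ (character lambda a) 0 y = zero.
Proof.
intros hy H.
destruct (bounded_linear_bound B HB) as (M & hM & HM).
set (Z := integ (character lambda a) 0 y).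
assert (E : D zero /\ A zero = minus (minus zero zero) (plus zero Z)).
  apply (closed_linear_operator_graph D A HD); intros eps heps.
  (* The error in the image is at most [(3 + M) * d]: two end values of [u'], the [B] term and the
     forcing term. *)
  set (d := eps / (4 + M)).
  assert (hd : 0 < d) by (apply Rdiv_lt_0_compat; lra).
  assert (Ed : eps = (4 + M) * d) by (unfold d; field; lra).
  clearbody d.
  destruct (H d hd) as (f' & u' & hf & hu & HI & h1 & h2).
  assert (hy0 : 0 <= y) by lra.
  destruct (HI 0 y hy0) as [h3 h4].
  assert (hMd : 0 <= M * d) by (apply Rmult_le_pos; lra).
  assert (hZ : norm (minus (integ f' 0 y) Z) <= d).
    apply Rle_trans with ((y - 0) * d); [|nra].
    apply integ_dist; try lra; try apply BUC_cts; auto using BUC_character.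
    intros t ht; apply h2; lra.
  assert (hu0 : norm (integ u' 0 y) <= d).
    apply Rle_trans with ((y - 0) * d); [|nra].
    apply integ_bound; auto using BUC_cts.
  assert (hB0 : norm (integ (B u') 0 y) <= M * d).
    apply Rle_trans with ((y - 0) * (M * d)); [|nra].
    apply integ_bound; auto; apply BUC_cts, HB, hu.
  exists (integ u' 0 y); split; [exact h3|]; rewrite h4; split.
  - rewrite minus_zero_r; nra.
  - refine (Rle_trans _ _ _ (dist_minus _ _ _ _) _).
    refine (Rle_trans _ _ _ (Rplus_le_compat _ _ _ _ (dist_minus _ _ _ _)
      (dist_plus _ _ _ _)) _).
    rewrite !minus_zero_r.
    generalize (h1 y) (h1 0); lra.
destruct E as [_ E].
rewrite (linear_operator_zero D A (closed_linear_operator_linear D A HD)) in E.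
rewrite minus_zero_r plus_zero_l minus_zero_l in E.
now rewrite -(opp_opp Z) -E opp_zero.
Qed.

(** On a short interval the character stays close to [a], so its vanishing integral is close to
    [y * a]. The chosen [y] satisfies [2 * l * y = 1 - y], whence [norm a <= (1 - y) * norm a]. *)
Lemma character_integ_injective (lambda : R) (a : X) :
  (forall y, 0 <= y <= 1 -> integ (character lambda a) 0 y = zero) -> a = zero.
Proof.
intros H; set (l := Rabs lambda).
assert (hl : 0 <= l) by apply Rabs_pos.
set (y := / (2 * l + 1)).
assert (hy : 0 < y) by (apply Rinv_0_lt_compat; lra).
assert (Ey : y * (2 * l + 1) = 1) by (unfold y; field; lra).
assert (hy1 : y <= 1) by nra.
assert (h := integ_dist (fun _ => a) (character lambda a) 0 y (2 * l * y * norm a)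
  (fun _ => continuous_const _ _) (BUC_cts _ (BUC_character lambda a))
  (Rlt_le _ _ hy)).
rewrite integ_const H in h; [|lra].
rewrite minus_zero_r norm_cscal Cmod_R Rminus_0_r (Rabs_pos_eq y) in h; [|lra].
apply norm_le_zero; assert (ha := norm_ge_0 a).
cut (y * norm a <= y * (2 * l * y * norm a)).
  intros h'; apply Rmult_le_reg_l in h'; [|exact hy].
  replace (2 * l * y * norm a) with ((y * (2 * l + 1) - y) * norm a) in h' by ring.
  rewrite Ey in h'; nra.
apply h; intros s hs.
unfold character; rewrite norm_minus_sym norm_expi_scal_minus.
apply Rmult_le_compat_r; [exact ha|].
rewrite -expi_0.
refine (Rle_trans _ _ _ (expi_lipschitz _ _) _).
rewrite Rminus_0_r Rabs_mult (Rabs_pos_eq s); [|lra].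
fold l; nra.
Qed.

Lemma bohr_spectrum_incl (f u : R -> X) (lambda : R) :
  BUC f -> BUC u -> almost_periodic u -> integrated_solution D A B f u ->
  bohr_spectrum f lambda -> bohr_spectrum u lambda.
Proof.
intros hf hu hAP Hfu (a & Ha & ha).
destruct (classic (exists c T0, 0 < c /\ 0 < T0 /\ forall T, T0 <= T ->
  2 * T * c <= norm (integ (twist lambda u) (- T) T))) as [(c & T0 & hc & hT0 & H)|H].
  now apply (bohr_spectrum_of_lower_bound lambda c T0).
contradict ha; apply (character_integ_injective lambda).
intros y hy; apply integ_character_zero; [exact hy|].
apply (character_approx lambda f u); auto.
(* Failure of every lower bound supplies arbitrarily large windows with arbitrarily small means of
   [u]. *)
intros c T0 hc hT0; apply NNPP; intros H'; apply H.
exists c, T0; split; [exact hc | split; [exact hT0|]].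
intros T hT; apply Rnot_lt_le; intros h; apply H'; now exists T.
Qed.

End Spectrum.

(** * Comparison of ranks by integer linear algebra *)

Section Rank.

Lemma lincomb_ext (c d : R -> R) (s : list R) :
  (forall w, In w s -> c w = d w) -> lincomb c s = lincomb d s.
Proof.
induction s as [|x s IH]; intros H; [reflexivity|].
simpl; rewrite (H x (or_introl eq_refl)) IH; [reflexivity|].
intros w hw; apply H; now right.
Qed.

Fixpoint zsum (F : R -> Z) (s : list R) : Z :=
  match s with nil => 0%Z | x :: s' => (F x + zsum F s')%Z end.

Lemma zsum_ext (F G : R -> Z) (s : list R) :
  (forall w, In w s -> F w = G w) -> zsum F s = zsum G s.
Proof.
induction s as [|x s IH]; intros H; [reflexivity|].
simpl; rewrite (H x (or_introl eq_refl)) IH; [reflexivity|].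
intros w hw; apply H; now right.
Qed.

Lemma zsum_app (F : R -> Z) (s t : list R) :
  zsum F (s ++ t) = (zsum F s + zsum F t)%Z.
Proof. induction s as [|x s IH]; simpl; [|rewrite IH]; lia. Qed.

Lemma zsum_mul_l (c : Z) (F : R -> Z) (s : list R) :
  zsum (fun w => (c * F w)%Z) s = (c * zsum F s)%Z.
Proof. induction s as [|x s IH]; simpl; [|rewrite IH]; ring. Qed.

Lemma zsum_minus (F G : R -> Z) (s : list R) :
  zsum (fun w => (F w - G w)%Z) s = (zsum F s - zsum G s)%Z.
Proof. induction s as [|x s IH]; simpl; [|rewrite IH]; ring. Qed.

Definition update (p : R) (v : Z) (z : R -> Z) : R -> Z :=
  fun w => match Req_EM_T w p with left _ => v | right _ => z w end.

(* Gaussian elimination: a row [p] with [a p k <> 0] clears column [k]. *)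
Lemma integer_relation (om : list R) : forall (s : list R) (a : R -> R -> Z),
  NoDup s -> (length om < length s)%nat ->
  exists z : R -> Z, (exists w, In w s /\ z w <> 0%Z) /\
    forall j, In j om -> zsum (fun w => (z w * a w j)%Z) s = 0%Z.
Proof.
induction om as [|k om IH]; intros s a hs hl.
  destruct s as [|x s]; [simpl in hl; lia|].
  exists (fun _ => 1%Z); split.
  - exists x; split; [now left | lia].
  - intros j [].
destruct (classic (forall w, In w s -> a w k = 0%Z)) as [H|H].
  destruct (IH s a hs) as (z & hz & Hz); [simpl in hl; lia|].
  exists z; split; [exact hz|].
  intros j [<-|hj]; [|now apply Hz].
  rewrite (zsum_ext _ (fun w => (0 * 0)%Z)).
  - now rewrite zsum_mul_l.
  - intros w hw; rewrite (H w hw); lia.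
apply not_all_ex_not in H; destruct H as [p H].
apply imply_to_and in H; destruct H as [hp hpk].
destruct (in_split p s hp) as (s1 & s2 & ->).
assert (hs' := NoDup_remove_1 _ _ _ hs).
assert (hp' := NoDup_remove_2 _ _ _ hs).
(* Elimination without fractions: cross-multiplication with the pivot row keeps the entries
   integral. *)
destruct (IH (s1 ++ s2) (fun w j => (a p k * a w j - a w k * a p j)%Z) hs')
  as (z & (w0 & hw0 & hz0) & Hz).
  rewrite length_app; rewrite length_app in hl; simpl in hl; lia.
set (S0 := zsum (fun w => (z w * a w k)%Z) (s1 ++ s2)).
(* Coefficients of the reduced rows are multiplied by the pivot, and [- S0] on row [p] cancels
   column [k]. *)
exists (update p (- S0) (fun w => (a p k * z w)%Z)); split.
  exists w0; split.
  - apply in_or_app; apply in_app_or in hw0; simpl; tauto.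
  - unfold update; destruct (Req_EM_T w0 p) as [e|_]; [subst w0; contradiction | nia].
assert (K : forall j, zsum (fun w =>
    (update p (- S0) (fun w => (a p k * z w)%Z) w * a w j)%Z) (s1 ++ p :: s2)
  = (a p k * zsum (fun w => (z w * a w j)%Z) (s1 ++ s2) - S0 * a p j)%Z).
  intros j; rewrite zsum_app; simpl; unfold update at 2.
  destruct (Req_EM_T p p) as [_|e]; [|contradiction].
  rewrite -zsum_mul_l zsum_app.
  assert (F : forall r, (forall w, In w r -> In w (s1 ++ s2)) ->
    zsum (fun w => (update p (- S0) (fun w => (a p k * z w)%Z) w * a w j)%Z) r
    = zsum (fun w => (a p k * (z w * a w j))%Z) r).
    intros r hr; apply zsum_ext; intros w hw.
    unfold update; destruct (Req_EM_T w p) as [e|_]; [|ring].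
    subst w; now apply hr in hw.
  rewrite (F s1) ?(F s2); try (intros w hw; apply in_or_app; tauto); ring.
intros j hj; rewrite K; destruct hj as [<-|hj].
- fold S0; ring.
- specialize (Hz j hj).
  rewrite (zsum_ext _ (fun w => (a p k * (z w * a w j) - a p j * (z w * a w k))%Z))
    in Hz; [|intros w _; ring].
  rewrite zsum_minus !zsum_mul_l in Hz; fold S0 in Hz; lia.
Qed.

Lemma lincomb_plus (c d : R -> R) (s : list R) :
  lincomb (fun w => c w + d w) s = lincomb c s + lincomb d s.
Proof. unfold lincomb; induction s as [|x s IH]; simpl; [|rewrite IH]; ring. Qed.

Lemma lincomb_single (n : Z) (x : R) (s : list R) : NoDup s ->
  lincomb (fun w => IZR (update x n (fun _ => 0%Z) w)) s
  = match in_dec Req_EM_T x s with left _ => IZR n * x | right _ => 0 end.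
Proof.
induction s as [|y s IH]; intros hs; [reflexivity|].
inversion hs as [|y' s' h1 h2]; subst.
simpl; fold (lincomb (fun w => IZR (update x n (fun _ => 0%Z) w)) s).
rewrite (IH h2); unfold update.
destruct (Req_EM_T y x) as [e|e].
- subst y; destruct (in_dec Req_EM_T x s); [contradiction | ring].
- destruct (in_dec Req_EM_T x s); ring.
Qed.

(* In [integer_basis] a basis element may be repeated in the list; collecting
   its occurrences gives coefficients indexed by the basis itself. *)
Lemma lincomb_collect (om s : list R) (n : R -> Z) : NoDup om ->
  (forall w, In w s -> In w om) ->
  exists m : R -> Z, lincomb (fun w => IZR (n w)) s = lincomb (fun w => IZR (m w)) om.
Proof.
intros hom; induction s as [|x s IH]; intros H.
- exists (fun _ => 0%Z); clear; unfold lincomb; simpl.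
  induction om as [|y om IH]; simpl; [|rewrite -IH]; ring.
- destruct IH as [m hm]; [intros w hw; apply H; now right|].
  exists (fun w => (m w + update x (n x) (fun _ => 0%Z) w)%Z).
  rewrite (lincomb_ext (fun w => IZR (m w + update x (n x) (fun _ => 0%Z) w))
    (fun w => IZR (m w) + IZR (update x (n x) (fun _ => 0%Z) w))).
  2:{ intros w _; apply plus_IZR. }
  rewrite lincomb_plus -hm (lincomb_single (n x) x om hom).
  destruct (in_dec Req_EM_T x om) as [_|e]; [simpl; unfold lincomb; ring|].
  exfalso; apply e, H; now left.
Qed.

(** Substitution of the coordinates followed by an interchange of finite sums. *)
Lemma lincomb_exchange (z : R -> Z) (a : R -> R -> Z) (om s : list R) :
  (forall w, In w s -> w = lincomb (fun j => IZR (a w j)) om) ->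
  lincomb (fun w => IZR (z w)) s
  = lincomb (fun j => IZR (zsum (fun w => (z w * a w j)%Z) s)) om.
Proof.
induction s as [|x s IH]; intros H.
- simpl; clear; induction om as [|y om IH]; simpl; [reflexivity|].
  unfold lincomb in *; simpl in *; rewrite -IH; ring.
- simpl; fold (lincomb (fun w => IZR (z w)) s).
  rewrite IH; [|intros w hw; apply H; now right].
  rewrite {2}(H x (or_introl eq_refl)).
  clear; induction om as [|y om IH]; unfold lincomb in *; simpl in *; [ring|].
  rewrite -IH plus_IZR mult_IZR; ring.
Qed.

(** If [s] were longer, [integer_relation] would give a nontrivial integer relation among the
    coordinate rows of [s], hence among the elements of [s]. *)
Lemma independent_length_le (s om : list R) : NoDup s -> NoDup om ->
  rationally_independent (fun w => In w s) ->
  (forall x, In x s -> exists (t : list R) (n : R -> Z),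
     (forall w, In w t -> In w om) /\ x = lincomb (fun w => IZR (n w)) t) ->
  (length s <= length om)%nat.
Proof.
intros hs hom hind H.
apply Nat.nlt_ge; intros hlt.
(* Stated for every real so that choice yields a total coordinate function; its values off [s] are
   arbitrary. *)
assert (H' : forall x, exists m : R -> Z,
  In x s -> x = lincomb (fun w => IZR (m w)) om).
  intros x; destruct (classic (In x s)) as [hx|hx].
  - destruct (H x hx) as (t & n & ht & E).
    destruct (lincomb_collect om t n hom ht) as [m hm].
    exists m; intros _; now rewrite -hm.
  - exists (fun _ => 0%Z); contradiction.
set (a := fun x => proj1_sig (constructive_indefinite_description _ (H' x))).
assert (ha : forall x, In x s -> x = lincomb (fun w => IZR (a x w)) om)
  by (intros x; exact (proj2_sig (constructive_indefinite_description _ (H' x)))).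
destruct (integer_relation om s a hs hlt) as (z & (w0 & hw0 & hz0) & Hz).
apply hz0.
assert (Q := hind s (fun w => inject_Z (z w)) hs (fun w hw => hw)).
assert (E : lincomb (fun w => Q2R (inject_Z (z w))) s = 0).
  rewrite (lincomb_ext _ (fun w => IZR (z w))).
  2:{ intros w _; unfold Q2R, inject_Z; simpl; field. }
  rewrite (lincomb_exchange z a om s ha) (lincomb_ext _ (fun _ => 0)).
  - clear; unfold lincomb; induction om as [|y om IH]; simpl; [|rewrite IH]; ring.
  - intros j hj; now rewrite (Hz j hj).
specialize (Q E w0 hw0); unfold Qeq in Q; simpl in Q; lia.
Qed.

End Rank.

Theorem corollary29 :
  forall (X : CompleteNormedModule C_AbsRing)
    (D : X -> Prop) (A : X -> X) (B : (R -> X) -> R -> X)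
    (l : nat) (f : R -> X),
    closed_linear_operator D A ->
    bounded_linear_on_BUC B ->
    autonomous B ->
    quasi_periodic l f ->
    forall k : nat, (k < l)%nat ->
      ~ exists u : R -> X, quasi_periodic k u /\ strong_mild_solution D A B f u.
Proof.
intros X D A B l f HD HB HT (hfAP & omf & hnf & hlf & hmf & hindf & _) k hkl
  (u & (huAP & omu & hnu & hlu & _ & _ & hspan) & Hsol).
assert (HI := strong_mild_integrated_solution D A B HD HB f u Hsol).
destruct Hsol as (hf & hu & _).
(* The independent family [omf] lies in the module of [f], hence in that of [u], which [omu] spans
   over the integers. *)
cut (length omf <= length omu)%nat; [lia|].
apply independent_length_le; auto.
intros x hx; apply hspan.
destruct (hmf x hx) as (s & n & hs & E).
exists s, n; split; [|exact E].
intros lambda hl; apply (bohr_spectrum_incl D A B HD HB HT f u); auto.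
Qed.
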